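(* Let $3\le t\le n-4$ and $m=\lfloor\frac{n-t-1}{3}\rfloor$. Among the set of all graphs $\mathscr{L}_{n,t}$, the first $\sum_{i=1}^{m}(n-t-3i)+1$ graphs, in the $S$-order, are $K_t^{n-t}$ followed by the graphs $G_j^i$ with $1\le i\le m$ and $i+1\le j\le n-t-2i$, ordered by increasing $i$ and, for fixed $i$, by decreasing $j$; that is, $$K_t^{n-t}\prec_s G^1_{n-t-2}\prec_s G^1_{n-t-3}\prec_s\cdots\prec_s G^1_3\prec_s G^1_2\prec_s G^2_{n-t-4}\prec_s G^2_{n-t-5}\prec_s\cdots\prec_s G^2_3\prec_s\cdots\prec_s G^i_{n-t-2i}\prec_s G^i_{n-t-2i-1}\prec_s\cdots\prec_s G^i_{i+1}\prec_s G^{i+1}_{n-t-2(i+1)}\prec_s\cdots\prec_s G^{m}_{m+1},$$ and every graph $G\in\mathscr{L}_{n,t}$ not in this list satisfies $G^{m}_{m+1}\prec_s G$.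
   Context: All graphs are finite, simple and connected, and are considered up to isomorphism. For $2\le t\le n$, $\mathscr{L}_{n,t}$ is the set of all $n$-vertex connected graphs with clique number $t$. For $s\ge 1$, $K_t^{s}$ denotes the (kite) graph obtained from the complete graph $K_t$ by attaching at a vertex $v_0$ of $K_t$ a path $v_0v_1\cdots v_s$, where $v_1,\dots,v_s$ are new vertices; it has $t+s$ vertices. For $1\le i\le\lfloor\frac{n-t}{2}\rfloor$ and $0\le j\le n-t-2i$, $G_j^i$ denotes the $n$-vertex graph obtained from $K_t^{n-t-i}$ (with attached path $v_0v_1\cdots v_{n-t-i}$) and a path $w_0w_1\cdots w_i$ on $i+1$ vertices by identifying $v_j$ with $w_0$. For an $n$-vertex graph $G$ with adjacency eigenvalues $\lambda_1(G),\dots,\lambda_n(G)$, the $k$th spectral moment is $S_k(G)=\sum_{i=1}^n\lambda_i(G)^k$, $k=0,1,\dots,n-1$. For two $n$-vertex graphs $G_1,G_2$ write $G_1\prec_s G_2$ ($G_1$ comes before $G_2$ in the $S$-order) if for some $k$ with $1\le k\le n-1$ we have $S_i(G_1)=S_i(G_2)$ for $i=0,1,\dots,k-1$ and $S_k(G_1)<S_k(G_2)$. *)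

(* Defs.v *)
From HB Require Import structures.
From mathcomp Require Import all_boot all_order all_algebra all_fingroup all_field.

Set Implicit Arguments.
Unset Strict Implicit.
Unset Printing Implicit Defensive.

Import Order.TTheory GRing.Theory Num.Theory.

Record sgraph (n : nat) := SGraph {
  adj :> rel 'I_n;
  adj_sym : symmetric adj;
  adj_irrefl : irreflexive adj
}.

Definition isomorphic n (G H : sgraph n) : bool :=
  [exists s : 'S_n, [forall x, [forall y, G x y == H (s x) (s y)]]].

Definition connected n (G : sgraph n) : bool :=
  [forall x, [forall y, connect G x y]].

Definition is_clique n (G : sgraph n) (A : {set 'I_n}) : bool :=
  [forall x in A, [forall y in A, (x != y) ==> G x y]].

Definition clique_number n (G : sgraph n) : nat :=
  \max_(A : {set 'I_n} | is_clique G A) #|A|.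

(* The class L_{n,t}, as a predicate on labelled graphs; it is invariant under
   [isomorphic]. *)
Definition in_L n (t : nat) (G : sgraph n) : bool :=
  connected G && (clique_number G == t).

Section Spectrum.
Local Open Scope ring_scope.

Definition adjmx n (G : sgraph n) : 'M[algC]_n :=
  \matrix_(x, y) (G x y)%:R.

(* The characteristic polynomial is monic, so this is a list s such that
   char_poly (adjmx G) = \prod_(z <- s) ('X - z%:P): the eigenvalues with
   multiplicity, in an unspecified order. *)
Definition eigenvalues n (G : sgraph n) : seq algC :=
  sval (closed_field_poly_normal (char_poly (adjmx G))).

Definition spectral_moment n (k : nat) (G : sgraph n) : algC :=
  \sum_(l <- eigenvalues G) l ^+ k.

(* [k : 'I_n] encodes k <= n - 1.  The order of algC restricts to the usual one
   on the real elements, and adjacency eigenvalues are real. *)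
Definition S_before n (G1 G2 : sgraph n) : bool :=
  [exists k : 'I_n,
    [&& (1 <= k)%N,
        [forall i : 'I_k, spectral_moment i G1 == spectral_moment i G2]
      & spectral_moment k G1 < spectral_moment k G2]].

End Spectrum.

Section OfEdges.
Variables (n : nat) (e : rel nat).

Definition of_edges_adj : rel 'I_n :=
  fun x y => (x != y) && (e x y || e y x).

Lemma of_edges_sym : symmetric of_edges_adj.
Proof. by move=> x y; rewrite /of_edges_adj eq_sym orbC. Qed.

Lemma of_edges_irrefl : irreflexive of_edges_adj.
Proof. by move=> x; rewrite /of_edges_adj eqxx. Qed.

(* The simple graph on {0, ..., n-1} underlying the relation e: symmetrised,
   loops removed, restricted to vertices below n. *)
Definition of_edges : sgraph n := SGraph of_edges_sym of_edges_irrefl.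

End OfEdges.

(* K_t lives on the vertices 0, ..., t-1. *)
Definition complete_edge (t : nat) : rel nat := fun x y => (x < t) && (y < t).

(* Vertex number k of the path v, N, N+1, N+2, ... starting at v. *)
Definition path_vertex (v N k : nat) : nat := if k is k'.+1 then N + k' else v.

(* From a graph e on {0, ..., N-1}, identify the first vertex of a path on s+1
   vertices with v; the other s vertices are numbered N, ..., N+s-1. *)
Definition attach_path (e : rel nat) (v N s : nat) : rel nat :=
  fun x y => e x y ||
    has (fun k => (x == path_vertex v N k) && (y == path_vertex v N k.+1))
        (iota 0 s).

(* K_t^s on {0, ..., t+s-1}, where v_0 is the vertex 0. *)
Definition kite_edge (t s : nat) : rel nat :=
  attach_path (complete_edge t) 0 t s.

(* The vertex v_j of K_t^s. *)
Definition kite_vertex (t j : nat) : nat := path_vertex 0 t j.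

(* K_t^{n-t} *)
Definition kite (n t : nat) : sgraph n := of_edges n (kite_edge t (n - t)).

(* G_j^i, obtained from K_t^{n-t-i}, which has n - i vertices. *)
Definition kite_branch (n t i j : nat) : sgraph n :=
  of_edges n
    (attach_path (kite_edge t (n - t - i)) (kite_vertex t j) (n - i) i).

(* K_t^{n-t}, then all G_j^i with 1 <= i <= m and i + 1 <= j <= n - t - 2i, by
   increasing i and, for equal i, by decreasing j. *)
Definition first_graphs (n t m : nat) : seq (sgraph n) :=
  kite n t ::
  [seq kite_branch n t i j
    | i <- index_iota 1 m.+1,
      j <- rev (index_iota i.+1 (n - t - 2 * i).+1)].

(* Main.v *)
From HB Require Import structures.
Require Import Defs.
From mathcomp Require Import all_boot all_order all_algebra all_fingroup all_field.
From mathcomp Require Import zify.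
From Stdlib Require Import Ring.

(** The S-order is read off characteristic polynomials.  Write phi(G) for the
characteristic polynomial of the adjacency matrix.  By Newton's identities, if
phi(G) - phi(H) has degree n - k and leading coefficient c, then the moments
of G and H agree below k and S_k(H) - S_k(G) = k c (power_sum_first_diff).
So G comes before H as soon as phi(G) - phi(H) is not constant and has a
positive leading coefficient (S_before_char_poly), and this criterion is
visibly transitive.

Let P_k be the characteristic polynomial of the path on k vertices, and let
Q_k be that of K_t^k, with Q_(-1) standing for that of K_(t-1).  Both
sequences satisfy u_(k+2) = x u_(k+1) - u_k.  For K_t at distance j from a
vertex that carries two pendant paths, of lengths a and b, cutting the first
edge of one pendant path (attach_path_det) gives
  phi(a, b, j) = P_a Q_(j+b) - P_(a-1) P_b Q_(j-1).
Bilinear expressions such as P_b Q_c - P_(b+1) Q_(c-1) are invariant under a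
simultaneous shift of both indices, so the difference of two such polynomials
collapses to a short expression whose leading term can be seen.  A graph moves
up in the order when the branching vertex moves one step towards the clique
(branch_towards_clique), when the two pendant paths become more equal
(balance_arms), and in two mixed moves (lengthen_short_arm,
shorten_equal_arms).  Chains of these moves order the list, and they place
every G_j^i with j <= i after the last listed graph (last_listed_before).

It remains to reduce an arbitrary graph to these.  Number its vertices so that
a clique comes first and the others follow in depth-first order
(search_labelling): each vertex outside the clique then has an earlier
neighbour, its parent.  Either the graph has an edge that is neither in the
clique nor to a parent, and S_2 is larger than on the list, or the graph is the
clique with trees attached (tree_or_more_edges).  For the latter S_2 and S_3 do
not depend on the trees, while a new leaf at a vertex of degree g adds 4g + 2
to S_4 (walks4_leaf).  Hence S_4 exceeds the value on the list unless all
vertices but at most one are attached to a leaf outside the clique.  In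
depth-first order this leaves the kite, the graphs G_j^i, and, when t = 3, a
triangle with pendant paths at two of its vertices (classify_trees).  The last
kind comes after some G_1^i (split_attachment), hence after the whole list. *)

Set Implicit Arguments.
Unset Strict Implicit.
Unset Printing Implicit Defensive.

Import Order.TTheory GRing.Theory Num.Theory.

(** * Polynomial identities by normalisation in a commutative ring *)

Local Open Scope ring_scope.

Section CRing.
Variable R : comNzRingType.
Definition czero : R := 0.
Definition cone : R := 1.
Definition cadd (x y : R) : R := x + y.
Definition cmul (x y : R) : R := x * y.
Definition csub (x y : R) : R := x - y.
Definition copp (x : R) : R := - x.
Definition cnat n : R := n%:R.
Definition cexp (x : R) n : R := x ^+ n.

(** These named operations have one fixed carrier.  Replacing the generic
operations by them makes equal subterms syntactically equal, whichever
structure they were elaborated with, so that [ring] recognises its atoms. *)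
Lemma cring_theory : ring_theory czero cone cadd cmul csub copp eq.
Proof.
split; rewrite /czero /cone /cadd /cmul /csub /copp //.
- exact: add0r.
- exact: addrC.
- exact: addrA.
- exact: mul1r.
- exact: mulrC.
- exact: mulrA.
- exact: mulrDl.
- exact: subrr.
Qed.
End CRing.

Ltac cring_fold R :=
  rewrite -?natr1;
  match goal with |- @eq _ ?x ?y => change (@eq (GRing.ComNzRing.sort R) x y) end;
  repeat match goal with
  | |- context [@GRing.natmul ?V ?x 2] => change (@GRing.natmul V x 2) with (@cadd R x x)
  | |- context [@GRing.natmul ?V ?x 1] => change (@GRing.natmul V x 1) with x
  | |- context [@GRing.natmul ?V ?x 0] => change (@GRing.natmul V x 0) with (@czero R)
  | |- context [@GRing.natmul ?V (@GRing.one ?W) ?n] =>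
      change (@GRing.natmul V (@GRing.one W) n) with (@cnat R n)
  | |- context [@GRing.exp ?V ?x ?n] => change (@GRing.exp V x n) with (@cexp R x n)
  | |- context [@GRing.add ?V ?x ?y] => change (@GRing.add V x y) with (@cadd R x y)
  | |- context [@GRing.mul ?V ?x ?y] => change (@GRing.mul V x y) with (@cmul R x y)
  | |- context [@GRing.opp ?V ?x] => change (@GRing.opp V x) with (@copp R x)
  | |- context [@GRing.one ?V] => change (@GRing.one V) with (@cone R)
  | |- context [@GRing.zero ?V] => change (@GRing.zero V) with (@czero R)
  end.

Ltac cring R := cring_fold R; ring.

Definition complex_poly : comNzRingType := {poly algC}.
Add Ring complex_poly_ring : (cring_theory complex_poly).
(** The indeterminate is given a name for the same reason as the ring
operations. *)
Definition complex_X : complex_poly := 'X.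
Ltac poly_cring :=
  repeat match goal with
  | |- context [polyX ?A] => change (polyX A) with complex_X
  end; cring complex_poly.

(** * Power sums and the first difference of two monic polynomials *)

Lemma size_drop_top (R : nzRingType) (p : {poly R}) n :
  (size p <= n.+1)%N -> p`_n = 0 -> (size p <= n)%N.
Proof.
move=> /leq_sizeP szp pn0; apply/leq_sizeP => j; rewrite leq_eqVlt.
by case/predU1P=> [<- //|]; apply: szp.
Qed.

Lemma size_prod_le (R : idomainType) (p q : {poly R}) a b c :
  (size p <= a.+1 -> size q <= b -> a + b <= c -> size (p * q)%R <= c)%N.
Proof.
move=> hp hq hc; apply: leq_trans (size_polyMleq p q) _.
apply: leq_trans hc; rewrite -subn1 leq_subLR addnA add1n.
exact: leq_add.
Qed.

Section Identity.
Variable A : comNzRingType.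
Add Ring Aring : (cring_theory A).

(** Cross-multiplied form of p'/p - q'/q.  The hypotheses on [a] and [b] are
Euler's operator with its leading term removed ([k + e] being the degree of
[p], and [e] that of [r]), and [g] is what is left of x^k r after removal of
its leading term: all the terms on the right then have degree less than [p *
q]. *)
Lemma cross_log_deriv
    (x y p q r p' q' r' W1 W2 E1 E2 c a b g k e : A) :
  q = p - r -> q' = p' - r' -> a = x * r' - r * e -> b = x * p' - p * (k + e) ->
  x * y * p' = p * W1 + E1 -> x * y * q' = q * W2 + E2 -> g = y * r - c * q ->
  p * q * (W1 - W2 + c * k) = y * (a * p - b * r) - p * g * k - (E1 * q - E2 * p).
Proof.
move=> hq hq' -> -> h1 h2 ->.
have -> : p * q * (W1 - W2 + c * k) = q * (p * W1 + E1) - p * (q * W2 + E2)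
  - (E1 * q - E2 * p) + p * q * (c * k) by cring A.
by rewrite -h1 -h2 hq hq'; cring A.
Qed.

End Identity.

Section PowerSums.
Variable R : idomainType.
Let Rx : comNzRingType := {poly R}.
Add Ring Rx_ring : (cring_theory Rx).
Implicit Types s : seq R.

Definition roots_poly s : {poly R} := \prod_(z <- s) ('X - z%:P).
Definition power_sum k s : R := \sum_(z <- s) z ^+ k.

Lemma size_roots_poly s : size (roots_poly s) = (size s).+1.
Proof. by rewrite size_prod_XsubC. Qed.

Lemma monic_roots_poly s : roots_poly s \is monic.
Proof. exact: monic_prod_XsubC. Qed.

(** p'/p is the sum of the 1/(x - z), and x^K / (x - z) has polynomial part the
sum of the z^r x^(K-1-r) and remainder z^K / (x - z). *)
Lemma log_deriv_roots_poly s K :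
  exists2 E : {poly R}, (size E <= size s)%N &
    'X^K * (roots_poly s)^`() =
      roots_poly s * \sum_(r < K) (power_sum r s)%:P * 'X^(K.-1 - r) + E.
Proof.
elim: s => [|z s [E szE IH]].
  exists 0; rewrite ?size_poly0 // /roots_poly /power_sum !big_nil.
  rewrite -polyC1 derivC mulr0 addr0 big1 ?mulr0 // => r _.
  by rewrite big_nil mul0r.
exists ((z ^+ K)%:P * roots_poly s + ('X - z%:P) * E).
  apply: leq_trans (size_polyD _ _) _; rewrite geq_max; apply/andP; split.
    apply: (@size_prod_le _ _ _ 0 (size s).+1) => //.
      exact: size_polyC_leq1.
    by rewrite size_roots_poly.
  by apply: (@size_prod_le _ _ _ 1 (size s)) => //; rewrite size_XsubC.
have -> : roots_poly (z :: s) = ('X - z%:P) * roots_poly s.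
  by rewrite /roots_poly big_cons.
rewrite derivM derivXsubC mul1r.
have -> : \sum_(r < K) (power_sum r (z :: s))%:P * 'X^(K.-1 - r) =
    \sum_(r < K) 'X^(K.-1 - r) * z%:P ^+ r
    + \sum_(r < K) (power_sum r s)%:P * 'X^(K.-1 - r).
  rewrite -big_split /=; apply: eq_bigr => r _.
  by rewrite /power_sum big_cons polyCD mulrDl polyC_exp [_ * 'X^_]mulrC.
have := subrXX ('X : {poly R}) z%:P K; rewrite -polyC_exp.
set W := \sum_(r < K) _ * _; set V := \sum_(r < K) _ * _ => eK.
have {eK}eK : 'X^K = ('X - z%:P) * W + (z ^+ K)%:P by rewrite -eK subrK.
rewrite mulrDr mulrCA IH {1}eK -/V; cring Rx.
Qed.

(** Newton's identities, in the form used here.  With W1 and W2 the two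
polynomial parts of x^(k+1) p'/p, comparing degrees in the cross-multiplied
difference shows that W1 - W2 is the constant -k c, where c is the leading
coefficient of [r]; its coefficients are the differences of power sums. *)
Lemma power_sum_first_diff s1 s2 k :
  size s1 = size s2 -> let r := roots_poly s1 - roots_poly s2 in
  r != 0 -> (k + (size r).-1 = size s1)%N ->
  (forall i, (i < k)%N -> power_sum i s1 = power_sum i s2) /\
  power_sum k s2 - power_sum k s1 = lead_coef r *+ k.
Proof.
move=> sz12 r r0 hk; set e := (size r).-1 in hk.
pose p := roots_poly s1; pose q := roots_poly s2; pose n := size s1.
have szr : size r = e.+1 by rewrite /e prednK // lt0n size_poly_eq0.
have szp : size p = n.+1 by rewrite size_roots_poly.
have szq : size q = n.+1 by rewrite size_roots_poly -sz12.
have pn : p`_n = 1.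
  by have /monicP := monic_roots_poly s1; rewrite /lead_coef -/p szp.
have qn : q`_n = 1.
  by have /monicP := monic_roots_poly s2; rewrite /lead_coef -/q szq.
set c := lead_coef r.
have re : r`_e = c by [].
have hkn : (k + e)%N = n by [].
have euler (f : {poly R}) d : size f = d.+1 -> (size ('X * f^`() - f *+ d)%R <= d)%N.
  move=> szf; apply: size_drop_top; last first.
    rewrite coefB coefXM coefMn coef_deriv.
    by case: d szf => [|d] _ /=; rewrite ?mulr0n ?subr0 ?subrr.
  apply: leq_trans (size_polyD _ _) _; rewrite size_polyN geq_max.
  apply/andP; split; last first.
    by apply/leq_sizeP => j hj; rewrite coefMn nth_default ?mul0rn // szf.
  apply/leq_sizeP => -[//|j] hj; rewrite coefXM coef_deriv /=.
  by rewrite nth_default ?mul0rn // szf.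
have [E1 szE1 h1] := log_deriv_roots_poly s1 k.+1.
have [E2 szE2 h2] := log_deriv_roots_poly s2 k.+1.
move: h1 h2; rewrite -/p -/q; set W1 := \sum_(_ < _) _; set W2 := \sum_(_ < _) _.
move=> h1 h2; have szrE := euler _ _ szr; have szpE := euler _ _ szp.
pose V := W1 - W2 + (c *+ k)%:P.
set a := 'X * r^`() - r *+ e in szrE; set b := 'X * p^`() - p *+ n in szpE.
pose g := 'X^k * r - c%:P * q.
have szg : (size g <= n)%N.
  apply: size_drop_top; last first.
    by rewrite coefB coefXnM coefCM qn mulr1 -hkn ltnNge leq_addr addKn re subrr.
  apply: leq_trans (size_polyD _ _) _; rewrite size_polyN geq_max.
  apply/andP; split; last first.
    apply: (@size_prod_le _ _ _ 0 n.+1) => //; first exact: size_polyC_leq1.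
    by rewrite szq.
  by apply: (@size_prod_le _ _ _ k e.+1); rewrite ?size_polyXn ?szr // addnS hkn.
have key : p * q * V = 'X^k * (a * p - b * r) - (p * g) *+ k - (E1 * q - E2 * p).
  rewrite /V polyCMn -[in LHS]mulr_natr -[(p * g) *+ k]mulr_natr.
  rewrite exprS in h1 h2.
  apply: (@cross_log_deriv _ _ _ _ _ _ _ _ r^`() _ _ _ _ _ _ _ _ _ e%:R _ _ _ _ h1 h2).
  - by rewrite /r opprB addrC subrK.
  - by rewrite /r derivB opprB addrC subrK.
  - by rewrite /a mulr_natr.
  - by rewrite /b -hkn -natrD mulr_natr.
  - by [].
have V0 : V = 0.
  apply/eqP/negPn/negP => nV0.
  have : (size (p * q * V)%R <= n + n)%N.
    rewrite key; do 2 (apply: leq_trans (size_polyD _ _) _; rewrite size_polyN geq_max;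
      apply/andP; split).
    - apply: (@size_prod_le _ _ _ k (e + n)); rewrite ?size_polyXn //; last first.
        by rewrite addnA hkn.
      apply: leq_trans (size_polyD _ _) _; rewrite size_polyN geq_max.
      apply/andP; split.
        by rewrite mulrC; apply: (@size_prod_le _ _ _ n e); rewrite ?szp // addnC.
      by rewrite mulrC; apply: (@size_prod_le _ _ _ e n); rewrite ?szr.
    - rewrite -mulrnAr; apply: (@size_prod_le _ _ _ n n); rewrite ?szp //.
      by apply/leq_sizeP => j hj; rewrite coefMn nth_default ?mul0rn // (leq_trans szg).
    - by rewrite mulrC; apply: (@size_prod_le _ _ _ n n); rewrite ?szq.
    - by rewrite mulrC; apply: (@size_prod_le _ _ _ n n); rewrite ?szp // /n sz12.
  have mpq : p * q \is monic by rewrite monicMr ?monic_roots_poly.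
  rewrite size_monicM // size_monicM ?monic_roots_poly ?monic_neq0 //; last first.
    exact: monic_roots_poly.
  have : (0 < size V)%N by rewrite lt0n size_poly_eq0.
  rewrite szp szq; lia.
have cW s (j : 'I_k.+1) :
    (\sum_(r < k.+1) (power_sum r s)%:P * 'X^(k.+1.-1 - r))`_(k - j) = power_sum j s.
  rewrite coef_sum (bigD1 j) //= coefCM coefXn eqxx mulr1 big1 ?addr0 // => i ij.
  rewrite coefCM coefXn; case: eqP => [E|]; last by rewrite mulr0.
  case/eqP: ij; apply: val_inj => /=; have := ltn_ord i; have := ltn_ord j; lia.
have cV (j : 'I_k.+1) :
    power_sum j s1 - power_sum j s2 + (c *+ k) *+ (k - j == 0)%N = 0.
  have := congr1 (fun f : {poly R} => f`_(k - j)) V0.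
  by rewrite /V coefD coefB !cW coefC coef0 => <-; case: eqP.
split=> [i ik|].
  have := cV (Ordinal (leqW ik)); rewrite /= subn_eq0 leqNgt ik mulr0n addr0.
  exact: subr0_eq.
have := cV ord_max; rewrite /= subnn eqxx mulr1n.
by move/eqP; rewrite addrC addr_eq0 opprB => /eqP ->.
Qed.
End PowerSums.

(** * Spectral moments as traces and as walk counts *)

Section SimilarMatrices.
Variables (F : fieldType) (n : nat).
Implicit Types P A D : 'M[F]_n.

Lemma char_poly_conj P D : P \in unitmx ->
  char_poly (invmx P *m D *m P) = char_poly D.
Proof.
move=> uP; pose up := map_mx (@polyC F) P; pose vp := map_mx (@polyC F) (invmx P).
have vu : vp *m up = 1%:M by rewrite -map_mxM mulVmx // map_mx1.
have -> : char_poly (invmx P *m D *m P) = \det (vp *m char_poly_mx D *m up).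
  congr (\det _); rewrite /char_poly_mx mulmxBr mulmxBl !map_mxM; congr (_ - _).
  by rewrite scalar_mxC -mulmxA vu mulmx1.
by rewrite !det_mulmx mulrAC -det_mulmx vu det1 mul1r.
Qed.

Lemma expr_conj P D k : P \in unitmx ->
  (invmx P *m D *m P) ^+ k = invmx P *m (D ^+ k) *m P.
Proof.
move=> uP; elim: k => [|k IH]; first by rewrite !expr0 mulmx1 mulVmx.
by rewrite !exprS IH -!mulmxE !mulmxA mulmxK.
Qed.

Lemma expr_diag_mx (d : 'rV[F]_n) k : diag_mx d ^+ k = diag_mx (\row_i d 0 i ^+ k).
Proof.
elim: k => [|k IH].
  rewrite expr0; apply/matrixP => i j; rewrite !mxE expr0.
  by [].
rewrite exprS IH -mulmxE mul_diag_mx; apply/matrixP => i j; rewrite !mxE.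
by rewrite exprS mulrnAr.
Qed.
End SimilarMatrices.

Section Moments.
Variable n : nat.
Implicit Types G H : sgraph n.

Lemma char_poly_eigenvalues G : char_poly (adjmx G) = roots_poly (eigenvalues G).
Proof.
rewrite /eigenvalues; case: closed_field_poly_normal => s /= hs.
by rewrite {1}hs (monicP (char_poly_monic _)) scale1r.
Qed.

Lemma size_eigenvalues G : size (eigenvalues G) = n.
Proof.
by apply: succn_inj; rewrite -size_roots_poly -char_poly_eigenvalues size_char_poly.
Qed.

Lemma spectral_momentE k G : spectral_moment k G = power_sum k (eigenvalues G).
Proof. by []. Qed.

Lemma S_before_first k G H : (0 < k < n)%N ->
  (forall i, (i < k)%N -> spectral_moment i G = spectral_moment i H) ->
  spectral_moment k G < spectral_moment k H -> S_before G H.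
Proof.
move=> /andP[k0 kn] heq hlt; apply/existsP; exists (Ordinal kn) => /=.
rewrite k0 hlt andbT /=; apply/forallP => i; apply/eqP/heq; exact: ltn_ord.
Qed.

(** The size condition is what keeps the first differing moment below n: if the
polynomials differ by a constant, the first difference is in S_n. *)
Lemma S_before_char_poly G H :
  (1 < size (char_poly (adjmx G) - char_poly (adjmx H))%R)%N ->
  0 < lead_coef (char_poly (adjmx G) - char_poly (adjmx H)) -> S_before G H.
Proof.
rewrite !char_poly_eigenvalues; set r := _ - _ => szr lr.
have r0 : r != 0 by rewrite -lead_coef_eq0 gt_eqF.
have rn : (size r <= n)%N.
  apply: size_drop_top.
    apply: leq_trans (size_polyD _ _) _.
    by rewrite size_polyN !size_roots_poly !size_eigenvalues maxnn.
  have := monicP (monic_roots_poly (eigenvalues H)).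
  have := monicP (monic_roots_poly (eigenvalues G)).
  rewrite /lead_coef !size_roots_poly !size_eigenvalues /= => h1 h2.
  by rewrite coefB h1 h2 subrr.
(* The degree of r is n - k. *)
pose k := (n - (size r).-1)%N.
have kE : (k + (size r).-1 = size (eigenvalues G))%N.
  by rewrite size_eigenvalues /k; lia.
have k0 : (0 < k)%N by rewrite /k; lia.
have sz : size (eigenvalues G) = size (eigenvalues H) by rewrite !size_eigenvalues.
have [heq hk] := power_sum_first_diff sz r0 kE.
apply: (@S_before_first k) => //; first by rewrite /k; lia.
by rewrite -subr_gt0 !spectral_momentE hk pmulrn_lgt0.
Qed.

(** A real symmetric matrix is diagonalisable, so its k-th power has trace the
sum of the k-th powers of the eigenvalues. *)
Lemma spectral_moment_tr k G : spectral_moment k G = \tr (adjmx G ^+ k).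
Proof.
have An : adjmx G \is normalmx.
  apply: symmetric_normalmx.
    apply/is_hermitianmxP; rewrite expr0 scale1r; apply/matrixP => i j.
    by rewrite !mxE adj_sym.
  by apply/mxOverP => i j; rewrite mxE realn.
have uP := spectral_unit (adjmx G).
have := orthomx_spectralP An; set P := spectralmx _; set d := spectral_diag _ => AE.
have perm_d : perm_eq (eigenvalues G) [seq d 0 i | i <- enum 'I_n].
  apply: prod_XsubC_eq; rewrite -/(roots_poly _) -char_poly_eigenvalues AE.
  rewrite char_poly_conj // char_poly_trig; last first.
    by apply/is_trig_mxP => i j ij; rewrite mxE -val_eqE ltn_eqF.
  by rewrite big_map big_enum /=; apply: eq_bigr => i _; rewrite mxE eqxx.
rewrite /spectral_moment (perm_big _ perm_d) /= big_map big_enum /=.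
rewrite AE expr_conj // mxtrace_mulC mulmxA mulmxV // mul1mx expr_diag_mx mxtrace_diag.
by apply: eq_bigr => i _; rewrite mxE.
Qed.

Lemma spectral_moment0 G : spectral_moment 0 G = n%:R.
Proof. by rewrite spectral_moment_tr expr0 mxtrace1. Qed.

Lemma spectral_moment1 G : spectral_moment 1 G = 0.
Proof.
rewrite spectral_moment_tr expr1; apply: big1 => i _.
by rewrite mxE adj_irrefl.
Qed.

Lemma adjmx2E G x y : (adjmx G ^+ 2) x y = (\sum_z (G x z && G z y))%:R.
Proof.
rewrite expr2 -mulmxE mxE natr_sum; apply: eq_bigr => z _.
by rewrite !mxE -natrM mulnb.
Qed.

Lemma spectral_moment2 G : spectral_moment 2 G = (\sum_x \sum_y G x y)%:R.
Proof.
rewrite spectral_moment_tr natr_sum; apply: eq_bigr => x _.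
by rewrite adjmx2E; congr (_%:R); apply: eq_bigr => y _; rewrite [G y x]adj_sym andbb.
Qed.

Lemma spectral_moment3 G : spectral_moment 3 G =
  (\sum_x \sum_y G x y * \sum_z (G x z && G z y))%:R.
Proof.
rewrite spectral_moment_tr natr_sum; apply: eq_bigr => x _.
rewrite exprSr -mulmxE mxE natr_sum; apply: eq_bigr => y _.
by rewrite adjmx2E mxE -natrM mulnC adj_sym.
Qed.

Lemma spectral_moment4 G : spectral_moment 4 G =
  (\sum_x \sum_y (\sum_z (G x z && G z y)) ^ 2)%:R.
Proof.
rewrite spectral_moment_tr natr_sum; apply: eq_bigr => x _.
rewrite (exprD _ 2 2) -mulmxE mxE natr_sum; apply: eq_bigr => y _.
rewrite !adjmx2E -natrM; congr (_ * _)%:R; apply: eq_bigr => z _.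
by rewrite andbC ![G _ z]adj_sym ![G z _]adj_sym.
Qed.

Lemma char_poly_iso G H (s : 'S_n) : (forall x y, G x y = H (s x) (s y)) ->
  char_poly (adjmx G) = char_poly (adjmx H).
Proof.
move=> GH; rewrite -[RHS](@char_poly_conj _ _ (perm_mx s^-1)) ?unitmx_perm //.
have -> : invmx (perm_mx s^-1) = perm_mx s :> 'M[algC]_n.
  rewrite -[RHS]mul1mx -(mulVmx (unitmx_perm _ s^-1)) -mulmxA -perm_mxM.
  by rewrite mulVg perm_mx1 mulmx1.
congr char_poly; rewrite -row_permE -col_permE.
by apply/matrixP => i j; rewrite !mxE GH.
Qed.

Lemma S_before_congr G G' H H' :
  char_poly (adjmx G) = char_poly (adjmx G') ->
  char_poly (adjmx H) = char_poly (adjmx H') -> S_before G H = S_before G' H'.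
Proof. by rewrite /S_before /spectral_moment /eigenvalues => -> ->. Qed.

End Moments.

(** * Determinants indexed by natural numbers *)

Section NatDet.
Variable R : comNzRingType.
Implicit Types M : nat -> nat -> R.

(** Matrices are indexed by [nat] here, so that a graph and its restrictions to
the first n vertices share one index type, and vertices can be added one at
a time. *)
Definition det_n n M : R := \det (\matrix_(i < n, j < n) M i j).

(** Row and column [u] are replaced by those of the identity instead of being
struck out: the determinant is that of the graph without [u], and the other
indices do not move. *)
Definition delete_vertex u M : nat -> nat -> R :=
  fun i j => if (i == u) || (j == u) then (i == j)%:R else M i j.

Lemma eq_det_n n M M' :
  (forall i j, (i < n)%N -> (j < n)%N -> M i j = M' i j) -> det_n n M = det_n n M'.
Proof. by move=> eM; congr (\det _); apply/matrixP => i j; rewrite !mxE eM. Qed.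

Lemma det_n_tr n M : det_n n (fun i j => M j i) = det_n n M.
Proof.
by rewrite -[RHS]det_tr; congr (\det _); apply/matrixP => i j; rewrite !mxE.
Qed.

Lemma det_n_last_row n M : (forall k, (k < n)%N -> M n k = 0) ->
  det_n n.+1 M = M n n * det_n n M.
Proof.
move=> M0; rewrite /det_n (expand_det_row _ ord_max) (bigD1 ord_max) //=.
rewrite big1 ?addr0 => [|j jn]; last first.
  have jn' : (j < n)%N by move: jn (ltn_ord j); rewrite -val_eqE /=; lia.
  by rewrite mxE M0 ?mul0r.
rewrite mxE /cofactor -signr_odd addnn odd_double mul1r; congr (_ * \det _).
by apply/matrixP => i j; rewrite !mxE !lift_max.
Qed.

Lemma det_n_last_col n M : (forall k, (k < n)%N -> M k n = 0) ->
  det_n n.+1 M = M n n * det_n n M.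
Proof. by move=> M0; rewrite -det_n_tr det_n_last_row // det_n_tr. Qed.

Lemma det_n_unit_row n u M : (u < n)%N -> (forall k, M u k = (u == k)%:R) ->
  det_n n M = det_n n (delete_vertex u M).
Proof.
move=> un Mu; pose uo := Ordinal un.
rewrite /det_n !(expand_det_row _ uo); apply: eq_bigr => j _.
rewrite !mxE /delete_vertex eqxx /= Mu; case: (u =P j) => [uj|]; last by rewrite !mul0r.
have -> : j = uo by apply: val_inj.
rewrite /cofactor; congr (_ * (_ * \det _)); apply/matrixP => k l; rewrite !mxE /=.
by rewrite ![bump u _ == u]eq_sym !(negPf (neq_bump _ _)).
Qed.

Lemma det_n_del_last n M : det_n n.+1 (delete_vertex n M) = det_n n M.
Proof.
rewrite det_n_last_row => [|k kn]; last by rewrite /delete_vertex eqxx /= gtn_eqF.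
rewrite /delete_vertex !eqxx mul1r; apply: eq_det_n => i j hi hj.
by rewrite (ltn_eqF hi) (ltn_eqF hj).
Qed.

Lemma det_n_swap n u v M : (u < n)%N -> (v < n)%N -> u != v ->
  det_n n (fun i j => M (if i == u then v else if i == v then u else i) j)
  = - det_n n M.
Proof.
move=> un vn uv; pose s := tperm (Ordinal un) (Ordinal vn).
have -> : - det_n n M = \det (perm_mx s *m \matrix_(i < n, j < n) M i j).
  by rewrite det_mulmx det_perm odd_tperm -val_eqE uv expr1 mulN1r.
rewrite -row_permE; congr (\det _); apply/matrixP => i j; rewrite !mxE.
congr M; rewrite permE /= -!val_eqE /=; by do 2 case: eqP => //=.
Qed.

Lemma det_n_row_add n u M r c : (u < n)%N ->
  det_n n (fun i j => if i == u then c * M u j + r j else M i j) =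
  c * det_n n M + det_n n (fun i j => if i == u then r j else M i j).
Proof.
move=> un; rewrite -[X in _ = _ + X]mul1r.
apply: (@determinant_multilinear _ _ _ _ _ (Ordinal un)).
- by apply/rowP => j; rewrite !mxE !eqxx mul1r.
- by apply/matrixP => i j; rewrite !mxE /= eq_sym (negPf (neq_bump _ _)).
- by apply/matrixP => i j; rewrite !mxE /= eq_sym (negPf (neq_bump _ _)).
Qed.

Lemma det_n_row_opp n u M r : (u < n)%N ->
  det_n n (fun i j => if i == u then - r j else M i j) =
  - det_n n (fun i j => if i == u then r j else M i j).
Proof.
move=> un; rewrite -mulN1r -[RHS]addr0.
rewrite -[X in _ = _ + X](mul0r (det_n n (fun i j => if i == u then r j else M i j))).
apply: (@determinant_multilinear _ _ _ _ _ (Ordinal un)).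
- by apply/rowP => j; rewrite !mxE !eqxx mul0r addr0 mulN1r.
- by apply/matrixP => i j; rewrite !mxE /= eq_sym (negPf (neq_bump _ _)).
- by apply/matrixP => i j; rewrite !mxE /= eq_sym (negPf (neq_bump _ _)).
Qed.

Variable x : R.

(** The new vertex [n] of a matrix of the form x I - A has [u] as its only
earlier neighbour. *)
Definition attached M n u :=
  M n n = x /\ forall k, (k < n)%N -> M n k = - (k == u)%:R /\ M k n = - (k == u)%:R.

(** Splitting the last row into its diagonal and off-diagonal parts gives the
two terms.  In the second, exchanging rows [u] and [n] puts a unit vector in
row [u]. *)
Lemma leaf_det_n n u M : (u < n)%N -> attached M n u ->
  det_n n.+1 M = x * det_n n M - det_n n (delete_vertex u M).
Proof.
move=> un [Mnn Mn].
pose M1 i j : R := if i == n then (j == n)%:R else M i j.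
have -> : det_n n.+1 M = x * det_n n.+1 M1 +
    det_n n.+1 (fun i j => if i == n then - (j == u)%:R else M1 i j).
  rewrite -det_n_row_add //; apply: eq_det_n => i j hi hj.
  rewrite /M1 eqxx; case: eqP => [->|//]; move: hj; rewrite ltnS leq_eqVlt.
  case/predU1P=> [->|hj]; first by rewrite Mnn eqxx gtn_eqF // mulr1 oppr0 addr0.
  by rewrite (ltn_eqF hj) mulr0 add0r; case: (Mn _ hj).
congr (x * _ + _).
  rewrite det_n_last_row => [|k kn]; last by rewrite /M1 eqxx ltn_eqF.
  rewrite /M1 !eqxx mul1r; apply: eq_det_n => i j hi hj; by rewrite ltn_eqF.
(* Row [u] is a unit vector, and row [n] is the former row [u]. *)
pose M4 i j : R := if i == u then (u == j)%:R else if i == n then M u j else M i j.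
have -> : det_n n.+1 (fun i j => if i == n then - (j == u)%:R else M1 i j) =
   det_n n.+1 M4.
  have un1 : (u < n.+1)%N by apply: leqW.
  have := det_n_row_opp (fun i j => if i == n then M u j else M i j)
    (fun j => (u == j)%:R) un1.
  rewrite -/M4 => h; rewrite -[RHS]opprK -h.
  rewrite -(det_n_swap _ un1 (ltnSn n)) ?(ltn_eqF un) //.
  apply: eq_det_n => i j _ _; rewrite /M1 /M4 (eq_sym u j).
  case: (i =P n) => [->|/eqP nin]; first by rewrite (gtn_eqF un) !eqxx.
  by case: (i =P u) => [->|/eqP niu]; rewrite ?(gtn_eqF un) ?eqxx ?(negPf nin) ?(negPf niu).
rewrite det_n_last_col => [|k kn]; last first.
  rewrite /M4; case: eqP => [_|/eqP ku]; first by rewrite (ltn_eqF un).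
  by rewrite (ltn_eqF kn); have [_ ->] := Mn _ kn; rewrite (negPf ku) oppr0.
have -> : M4 n n = -1.
  by rewrite /M4 (gtn_eqF un) eqxx; have [_ ->] := Mn _ un; rewrite eqxx.
rewrite mulN1r (@det_n_unit_row _ u) => [||k]; rewrite ?/M4 ?eqxx //.
congr (- _); apply: eq_det_n => i j hi hj; rewrite /delete_vertex.
by case: ifP => // /norP [/negPf -> _]; rewrite ltn_eqF.
Qed.

End NatDet.

(** * Linear recurrences and attached paths *)

Section LinearRecurrence.
Variables (R : comNzRingType) (x : R).
Add Ring Rring : (cring_theory R).
Implicit Types a b : R.

(** The sequence with u_0 = a, u_1 = b and u_(k+2) = x u_(k+1) - u_k, which is
how the characteristic polynomial grows along a pendant path. *)
Fixpoint linrec a b k : R := if k is k'.+1 then linrec b (x * b - a) k' else a.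

Lemma linrecSS a b k : linrec a b k.+2 = x * linrec a b k.+1 - linrec a b k.
Proof.
elim: k a b => [|k IH] a b //.
by rewrite [LHS]/= -/(linrec (x * b - a) (x * (x * b - a) - b) k) -[LHS]/(linrec b
  (x * b - a) k.+2) IH.
Qed.

(** The characteristic polynomial of the path on k - 1 vertices; the shift makes
index 0 the value 0 that precedes the empty graph. *)
Definition pathp k := linrec 0 1 k.

Lemma pathpSS k : pathp k.+2 = x * pathp k.+1 - pathp k.
Proof. exact: linrecSS. Qed.

Lemma nat_ind2 (P : nat -> Prop) : P 0%N -> P 1%N ->
  (forall k, P k -> P k.+1 -> P k.+2) -> forall k, P k.
Proof.
move=> P0 P1 PSS k; suff: P k /\ P k.+1 by case.
by elim: k => [|k [IH1 IH2]]; split => //; apply: PSS.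
Qed.

Lemma linrec_pathp a b k : linrec a b k.+1 = pathp k.+1 * b - pathp k * a.
Proof.
elim/nat_ind2: k => [||k IH1 IH2]; first by rewrite /pathp /=; cring R.
  by rewrite /pathp /=; cring R.
by rewrite linrecSS IH1 IH2 (pathpSS k.+1) (pathpSS k); cring R.
Qed.

(** Cutting a path at an edge. *)
Lemma linrec_add a b k l :
  linrec a b (k + l).+1 = pathp k.+1 * linrec a b l.+1 - pathp k * linrec a b l.
Proof.
elim/nat_ind2: k => [||k IH1 IH2]; first by rewrite /pathp add0n /= mul1r mul0r subr0.
  by rewrite add1n linrecSS /pathp /= mul1r; cring R.
by rewrite 2!addSn linrecSS -addSn IH1 IH2 (pathpSS k.+1) (pathpSS k); cring R.
Qed.

(** The expression on the left is invariant under a simultaneous shift of both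
indices, and for k = 0 it is the right-hand side. *)
Lemma linrec_cassini a b k l :
  pathp k.+1 * linrec a b (l + k) - pathp k * linrec a b (l + k).+1 = linrec a b l.
Proof.
elim: k l => [|k IH] l; first by rewrite /pathp addn0 /= mul1r mul0r subr0.
by rewrite !addnS linrecSS (pathpSS k) -[RHS](IH l); cring R.
Qed.

(** Both sides satisfy the recurrence of [linrec] in the length of the pendant
path, and the leaf formula settles length one. *)
Lemma attach_path_det M n0 u s : (u < n0)%N ->
  (forall k, (k < s)%N -> attached x M (n0 + k) (path_vertex u n0 k)) ->
  det_n (n0 + s) M = pathp s.+1 * det_n n0 M - pathp s * det_n n0 (delete_vertex u M).
Proof.
move=> un; elim/nat_ind2: s => [_||s IH1 IH2 aM].
- by rewrite /pathp addn0 /= mul1r mul0r subr0.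
- move=> /(_ 0%N isT); rewrite addn0 addn1 /= => aM.
  by rewrite (leaf_det_n un aM) /pathp /=; cring R.
have := aM s.+1 (ltnSn _); rewrite !addnS /= => aMs.
rewrite (leaf_det_n _ aMs) // det_n_del_last -addnS.
rewrite IH1 => [|k ks]; last by apply: aM; rewrite leqW // leqW.
rewrite IH2 => [|k ks]; last by apply: aM; rewrite leqW.
by rewrite (pathpSS s.+1) (pathpSS s); cring R.
Qed.

End LinearRecurrence.

Section CompleteDet.
Variables (R : idomainType) (y : R).
Let R' : comNzRingType := R.
Add Ring Rring : (cring_theory R').

(** The matrix is y I - J with J of rank one.  Bordering it by a row and a
column of ones and eliminating in two ways gives the identity multiplied by
y. *)
Lemma det_complete s : y != 0 ->
  det_n s.+1 (fun i j => if i == j then y - 1 else -1) = (y - s.+1%:R) * y ^+ s.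
Proof.
move=> y0; pose r : 'M[R]_(1, s.+1) := const_mx 1; pose c : 'M[R]_(s.+1, 1) := const_mx 1.
pose B := block_mx (1%:M : 'M_1) r c (y%:M : 'M_s.+1).
have h1 : det_n s.+1 (fun i j => if i == j then y - 1 else -1) = \det B.
  have : \det (block_mx 1%:M 0 (- c) 1%:M *m B) = \det B.
    by rewrite det_mulmx det_lblock !det1 !mul1r.
  rewrite mulmx_block !mul1mx !mul0mx !addr0 mulmx1 addNr det_ublock det1 mul1r => <-.
  congr (\det _); apply/matrixP => i j; rewrite !mxE big_ord1 !mxE -val_eqE /=.
  by case: eqP => _; rewrite ?mulr1n ?mulr0n; cring R'.
have h2 : \det B * y = (y - s.+1%:R) * y ^+ s.+1.
  have : \det (B *m block_mx (y%:M : 'M_1) 0 (- c) 1%:M) = \det B * y.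
    by rewrite det_mulmx det_lblock det1 mulr1 det_scalar1.
  rewrite mulmx_block !mul1mx !mulmx0 !add0r !mulmx1 mulmxN mul_mx_scalar.
  rewrite mul_scalar_mx scalerN subrr det_ublock det_scalar => <-.
  congr (_ * _); rewrite [X in \det X]mx11_scalar det_scalar1 !mxE /= mulr1n.
  rewrite (eq_bigr (fun=> 1)) ?sumr_const ?card_ord // => i _.
  by rewrite !mxE mulr1.
apply: (mulIf y0); rewrite h1 h2 exprSr; cring R'.
Qed.

Lemma det_complete_del0 s : y != 0 ->
  det_n s.+2 (delete_vertex 0 (fun i j => if i == j then y - 1 else -1)) =
  (y - s.+1%:R) * y ^+ s.
Proof.
move=> y0; rewrite -det_complete // /det_n (expand_det_row _ ord0) (bigD1 ord0) //=.
rewrite big1 ?addr0 => [|j]; last first.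
  rewrite mxE /delete_vertex eqxx /= -val_eqE /= eq_sym => /negPf ->.
  by rewrite mul0r.
rewrite mxE /delete_vertex /= mul1r /cofactor addn0 expr0 mul1r; congr (\det _).
by apply/matrixP => i j; rewrite !mxE /=.
Qed.
End CompleteDet.

(** * Cliques with trees and their characteristic polynomials *)

(** Trees attached to a clique, encoded by a parent function: after renumbering,
the connected graphs with clique number t and the fewest edges have this
form. *)
Definition ptree (t : nat) (f : nat -> nat) : rel nat := fun x y =>
  (x != y) && [|| (x < t) && (y < t), (t <= x) && (y == f x) | (t <= y) && (x == f y)]%N.

Definition pgraph n t f : sgraph n := of_edges n (ptree t f).

Definition parents t (f : nat -> nat) n := forall x, (t <= x < n)%N -> (f x < x)%N.

Lemma ptree_sym t f : symmetric (ptree t f).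
Proof.
by move=> x y; rewrite /ptree eq_sym [(x < t)%N && _]andbC [X in _ || X]orbC.
Qed.

Lemma pgraphE n t f (x y : 'I_n) : pgraph n t f x y = ptree t f x y.
Proof.
rewrite /= /of_edges_adj [ptree t f y x]ptree_sym orbb /ptree -val_eqE /=.
by case: eqP.
Qed.

Lemma ptree_leaf t f n k : parents t f n.+1 -> (t <= n)%N -> (k < n)%N ->
  ptree t f n k = (k == f n).
Proof.
move=> pf tn kn; rewrite /ptree (gtn_eqF kn) tn /= [(n < t)%N]ltnNge tn /=.
case: eqP => //= _; apply/negP => /andP[tk /eqP nE].
have := pf k; rewrite tk leqW //= -nE => /(_ isT); lia.
Qed.

Lemma parentsW t f n m : (m <= n)%N -> parents t f n -> parents t f m.
Proof. by move=> mn pf x /andP[tx xm]; apply: pf; rewrite tx (leq_trans xm). Qed.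

Section CharPoly.

Definition char_fun t f (i j : nat) : {poly algC} :=
  if i == j then 'X else - (ptree t f i j)%:R.

Lemma char_poly_pgraph n t f : char_poly (adjmx (pgraph n t f)) = det_n n (char_fun t f).
Proof.
congr (\det _); apply/matrixP => i j; rewrite !mxE pgraphE /char_fun -val_eqE /=.
case: eqP => [->|_]; first by rewrite mulr1n /ptree eqxx /= subr0.
by rewrite mulr0n sub0r; case: ptree; rewrite ?polyC1 ?polyC0.
Qed.

Lemma char_fun_attached t f n : parents t f n.+1 -> (t <= n)%N ->
  attached 'X (char_fun t f) n (f n).
Proof.
move=> pf tn; split; first by rewrite /char_fun eqxx.
move=> k kn; rewrite /char_fun (gtn_eqF kn) (ltn_eqF kn) [ptree t f k n]ptree_sym.
by rewrite (ptree_leaf pf).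
Qed.

Lemma del_attached (R : comNzRingType) (x : R) M n u w : (w < n)%N -> u != w ->
  attached x M n u -> attached x (delete_vertex w M) n u.
Proof.
move=> wn uw [Mnn Mn]; split; first by rewrite /delete_vertex (gtn_eqF wn).
move=> k kn; rewrite /delete_vertex (gtn_eqF wn) orbF /=; case: eqP => [->|_];
  last exact: Mn.
by rewrite (gtn_eqF wn) (ltn_eqF wn) eq_sym (negPf uw) oppr0.
Qed.

(** Once its parent is deleted, the last vertex is isolated. *)
Lemma del_parent_det t f n : parents t f n.+1 -> (t <= n)%N ->
  det_n n.+1 (delete_vertex (f n) (char_fun t f)) =
  'X * det_n n (delete_vertex (f n) (char_fun t f)).
Proof.
move=> pf tn; have fn : (f n < n)%N by apply: pf; rewrite tn ltnSn.
rewrite det_n_last_row => [|k kn].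
  by rewrite /delete_vertex (gtn_eqF fn) /char_fun eqxx.
rewrite /delete_vertex (gtn_eqF fn) /=; case: eqP => [->|/eqP kf];
  first by rewrite (gtn_eqF fn).
by rewrite /char_fun (gtn_eqF kn) (ptree_leaf pf) // (negPf kf) oppr0.
Qed.

Definition clique_poly t : {poly algC} := ('X + 1 - t%:R) * ('X + 1) ^+ t.-1.
(** The characteristic polynomial of K_t with a pendant path of k - 1 vertices;
index 0 is K_(t-1), which is what remains of K_t when the vertex that
carries the path is deleted. *)
Definition kite_poly t k : {poly algC} := linrec 'X (clique_poly t.-1) (clique_poly t) k.
Local Notation P := (pathp ('X : {poly algC})).

Lemma X1_neq0 : ('X + 1 : {poly algC}) != 0.
Proof. by have := polyXsubC_eq0 (-1 : algC); rewrite polyCN opprK polyC1 => ->. Qed.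

Lemma char_fun_complete t f i j : (i < t)%N -> (j < t)%N ->
  char_fun t f i j = if i == j then 'X + 1 - 1 else -1.
Proof.
by move=> hi hj; rewrite /char_fun /ptree hi hj; case: eqP; rewrite //= addrK.
Qed.

Lemma det_clique t f : (0 < t)%N -> det_n t (char_fun t f) = clique_poly t.
Proof.
case: t => // t _; rewrite /clique_poly -det_complete ?X1_neq0 //.
by apply: eq_det_n => i j hi hj; rewrite char_fun_complete.
Qed.

Lemma det_clique_del0 t f : (1 < t)%N -> det_n t (delete_vertex 0 (char_fun t f)) =
  clique_poly t.-1.
Proof.
case: t => [|[|t]] // _; rewrite /clique_poly -det_complete_del0 ?X1_neq0 //.
by apply: eq_det_n => i j hi hj; rewrite /delete_vertex char_fun_complete.
Qed.

Definition kite_parent (t x : nat) := if x == t then 0%N else x.-1.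
(** The path t, t + 1, ... hanging from vertex 0 of the clique is broken at x0,
and the rest of it is hung from z. *)
Definition branch_parent (t x0 z x : nat) := if x == x0 then z else kite_parent t x.

Lemma kite_parent_parents t n : (0 < t)%N -> parents t (kite_parent t) n.
Proof. by move=> t0 x; rewrite /kite_parent; case: eqP; lia. Qed.

Lemma branch_parent_parents t x0 z n : (0 < t)%N -> (z < x0)%N ->
  parents t (branch_parent t x0 z) n.
Proof.
move=> t0 zx x hx; rewrite /branch_parent /kite_parent; case: (x =P x0) => [->|_] //.
by case: (x =P t); lia.
Qed.

Lemma det_kite t f s : (1 < t)%N ->
  (forall x, (t <= x < t + s)%N -> f x = kite_parent t x) ->
  det_n (t + s) (char_fun t f) = kite_poly t s.+1.
Proof.
move=> t1 hf; rewrite (@attach_path_det _ 'X _ t 0); last 1 first.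
- move=> k ks; have -> : path_vertex 0 t k = f (t + k)%N.
    rewrite hf /kite_parent; last lia.
    case: k ks => [|k] /= ks; first by rewrite addn0 eqxx.
    case: eqP; lia.
  apply: char_fun_attached; last lia.
  move=> x hx; rewrite hf; last lia.
  by apply: (@kite_parent_parents t x.+1); lia.
- by rewrite /kite_poly linrec_pathp det_clique ?det_clique_del0 //; lia.
- lia.
Qed.

(** The value of phi(a, b, j): K_t at distance j from a vertex that carries
pendant paths of lengths a and b. *)
Definition branch_poly t a b j : {poly algC} :=
  P a.+1 * kite_poly t (j + b).+1 - P a * P b.+1 * kite_poly t j.

(** Cut the path of length [a] off the branching vertex: what remains is a kite.
Without the branching vertex, what remains is a shorter kite and the path of
length [b]. *)
Lemma det_branch t a b j : (1 < t)%N -> (0 < j)%N ->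
  det_n (t + j + b + a) (char_fun t (branch_parent t (t + j + b) (t + j).-1))
  = branch_poly t a b j.
Proof.
move=> t1 j0; set x0 := (t + j + b)%N; set z := (t + j).-1; set f := branch_parent _ _ _.
have zx : (z < x0)%N by rewrite /z /x0; lia.
have pf n : parents t f n by apply: branch_parent_parents => //; lia.
have fE x : (t <= x < x0)%N -> f x = kite_parent t x.
  by move=> hx; rewrite /f /branch_parent; case: eqP => //; lia.
have path_f k : path_vertex z x0 k = f (x0 + k)%N.
  rewrite /f /branch_parent; case: k => [|k] /=; first by rewrite addn0 eqxx.
  by rewrite /kite_parent; do 2 (case: eqP; first lia); lia.
rewrite (@attach_path_det _ 'X _ x0 z) //; last first.
  move=> k ka; rewrite path_f; apply: char_fun_attached => //.
  by rewrite /x0; lia.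
rewrite /branch_poly; congr (_ * _ - _).
  by rewrite /x0 -addnA det_kite // => x hx; apply: fE; rewrite /x0; lia.
rewrite -mulrA; congr (_ * _).
have detz : det_n z (char_fun t f) = kite_poly t j.
  have -> : z = (t + j.-1)%N by rewrite /z; lia.
  by rewrite det_kite ?prednK // => x hx; apply: fE; rewrite /x0; lia.
have x0E : x0 = (z.+1 + b)%N by rewrite /x0 /z; lia.
rewrite x0E; case: b @x0 @f zx pf fE path_f detz x0E => [|b] x0 f zx pf fE path_f detz x0E.
  by rewrite addn0 det_n_del_last detz /pathp /= mul1r.
have fz1 : f z.+1 = z.
  by rewrite fE /kite_parent; [case: eqP; rewrite /z; lia | rewrite /x0 /z; lia].
have tz : (t <= z)%N by rewrite /z; lia.
have detz1 : det_n z.+2 (delete_vertex z (char_fun t f)) = 'X * kite_poly t j.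
  have := del_parent_det (pf z.+2) (leqW tz).
  by rewrite fz1 det_n_del_last detz.
rewrite addnS -addSn (@attach_path_det _ 'X _ z.+2 z.+1) //; last first.
  move=> k kb; have -> : path_vertex z.+1 z.+2 k = f (z.+2 + k)%N.
    rewrite fE /kite_parent; last by rewrite /x0; lia.
    by case: eqP => h; [lia|case: k kb h => [|k] /=; lia].
  apply: del_attached; first lia.
    rewrite fE /kite_parent; last by rewrite /x0; lia.
    by case: (z.+2 + k =P t)%N; lia.
  by apply: char_fun_attached => //; lia.
have -> : det_n z.+2 (delete_vertex z.+1 (delete_vertex z (char_fun t f))) = kite_poly t j.
  by rewrite det_n_del_last det_n_del_last detz.
by rewrite detz1 (pathpSS _ b); poly_cring.
Qed.

(** A triangle with pendant paths of lengths a and b at two different vertices. *)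
Definition two_path_poly a b : {poly algC} := P a.+1 * kite_poly 3 b.+1 - P a * P b.+3.

(** Without the second vertex, the triangle and the other pendant path form a
single path. *)
Lemma det_triangle a b :
  det_n (3 + b + a) (char_fun 3 (branch_parent 3 (3 + b) 1)) = two_path_poly a b.
Proof.
set x0 := (3 + b)%N; set f := branch_parent _ _ _.
have pf n : parents 3 f n by apply: branch_parent_parents.
have fE x : (3 <= x < x0)%N -> f x = kite_parent 3 x.
  by move=> hx; rewrite /f /branch_parent; case: eqP => //; lia.
have path_f k : path_vertex 1 x0 k = f (x0 + k)%N.
  rewrite /f /branch_parent; case: k => [|k] /=; first by rewrite addn0 eqxx.
  by rewrite /kite_parent; do 2 (case: eqP; first lia); lia.
rewrite (@attach_path_det _ 'X _ x0 1) //; last first.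
  by move=> k ka; rewrite path_f; apply: char_fun_attached.
rewrite /two_path_poly; congr (_ * _ - _ * _).
  by rewrite /x0 det_kite.
rewrite (@attach_path_det _ 'X _ 3 0) //; last first.
  move=> k kb; have fk : f (3 + k)%N = path_vertex 0 3 k.
    by rewrite fE /kite_parent; [case: k kb => [|k] //=; case: eqP; lia | rewrite /x0; lia].
  apply: del_attached => //; first by case: k {kb fk}.
  by rewrite -fk; apply: char_fun_attached.
have M3 i j : (i < 3)%N -> (j < 3)%N -> char_fun 3 f i j = if i == j then 'X else -1.
  by move=> hi hj; rewrite char_fun_complete // addrK.
have h2 : det_n 3 (delete_vertex 1 (char_fun 3 f)) = 'X * 'X - 1.
  have a2 : attached 'X (delete_vertex 1 (char_fun 3 f)) 2 0.
    by split=> [|[|[|k]]] // _; rewrite /delete_vertex /= ?M3 //= ?oppr0.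
  rewrite (@leaf_det_n _ 'X 2 0) // det_n_del_last /det_n det_mx11 mxE M3 //=.
  rewrite -/(det_n 2 _) (@det_n_last_row _ 1); last by case=> // _;
    rewrite /delete_vertex /=.
  by rewrite /delete_vertex /= mul1r /det_n det_mx11 mxE.
have h1 : det_n 3 (delete_vertex 0 (delete_vertex 1 (char_fun 3 f))) = 'X.
  rewrite (@det_n_last_row _ 2); last first.
    by case=> [|[|k]] // _; rewrite /delete_vertex /=.
  rewrite (@det_n_last_row _ 1); last by case=> // _; rewrite /delete_vertex /=.
  by rewrite /det_n det_mx11 mxE /delete_vertex /= M3 //= !mulr1.
rewrite h1 h2 !pathpSS /pathp; case: b @x0 @f pf fE path_f M3 h1 h2 => [|b] *;
  rewrite /=; poly_cring.
Qed.
End CharPoly.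

(** * Signs of differences of characteristic polynomials *)

Section PositivePolynomials.
Variable R : numDomainType.
Implicit Types p q : {poly R}.

Definition pos_poly p := 0 < lead_coef p.
(** The condition on phi(G) - phi(H) under which G comes before H; the letters
stand for not constant and positive. *)
Definition ncpos_poly p := (1 < size p)%N && pos_poly p.

Lemma pos_poly_neq0 p : pos_poly p -> p != 0.
Proof. by rewrite /pos_poly -lead_coef_eq0; apply: lt0r_neq0. Qed.

Lemma pos_polyM p q : pos_poly p -> pos_poly q -> pos_poly (p * q).
Proof. by rewrite /pos_poly lead_coefM; apply: mulr_gt0. Qed.

Lemma monic_pos_poly p : p \is monic -> pos_poly p.
Proof. by rewrite /pos_poly => /monicP ->. Qed.

Lemma pos_poly_natM k p : (0 < k)%N -> pos_poly p -> pos_poly (k%:R * p).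
Proof.
move=> k0; apply: pos_polyM; rewrite /pos_poly -polyC_natr lead_coefC.
by rewrite ltr0n.
Qed.

Lemma pos_polyDl p q : pos_poly p -> (size q < size p)%N -> pos_poly (p + q).
Proof. by move=> pp sq; rewrite /pos_poly lead_coefDl. Qed.

Lemma pos_polyD p q : pos_poly p -> pos_poly q ->
  pos_poly (p + q) /\ (size p <= size (p + q)%R)%N.
Proof.
move=> pp pq; case: (ltngtP (size q) (size p)) => [h|h|h].
- by split; [exact: pos_polyDl|rewrite size_polyDl].
- by rewrite addrC; split; [exact: pos_polyDl|rewrite size_polyDl // ltnW].
have c0 : 0 < (p + q)`_(size p).-1.
  by rewrite coefD -{2}h addr_gt0.
have szp : (0 < size p)%N by rewrite lt0n size_poly_eq0 pos_poly_neq0.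
have sz : size (p + q) = size p.
  apply/eqP; rewrite eqn_leq; apply/andP; split.
    by rewrite (leq_trans (size_polyD _ _)) // h maxnn.
  rewrite leqNgt; apply/negP => hlt; move: c0; rewrite nth_default ?ltxx //.
  by rewrite -ltnS prednK.
by rewrite /pos_poly /lead_coef sz c0.
Qed.

Lemma ncpos_polyD p q : ncpos_poly p -> ncpos_poly q -> ncpos_poly (p + q).
Proof.
move=> /andP[sp pp] /andP[sq pq]; have [h1 h2] := pos_polyD pp pq.
by rewrite /ncpos_poly h1 (leq_trans sp).
Qed.

Lemma ncpos_polyM p q : ncpos_poly p -> pos_poly q -> ncpos_poly (p * q).
Proof.
move=> /andP[sp pp] pq; rewrite /ncpos_poly pos_polyM // andbT.
rewrite size_mul ?pos_poly_neq0 //; have := pos_poly_neq0 pq.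
rewrite -size_poly_gt0; case: (size q) => // k _.
by rewrite addnS (leq_trans sp) ?leq_addr.
Qed.

Lemma size_natM_le k p : (size (k%:R * p)%R <= size p)%N.
Proof.
rewrite mulr_natl; apply/leq_sizeP => j hj.
by rewrite coefMn nth_default ?mul0rn.
Qed.

End PositivePolynomials.

Section Comparisons.
Local Notation P := (pathp ('X : {poly algC})).

Lemma size_pathp k : size (P k) = k.
Proof.
elim/nat_ind2: k => [||k IH1 IH2]; rewrite ?size_poly0 ?size_poly1 //.
have h : size ('X * P k.+1) = k.+2 by rewrite mulrC size_mulX ?IH2 // -size_poly_eq0 IH2.
by rewrite pathpSS size_polyDl ?size_polyN ?h ?IH1.
Qed.

Lemma pathp_neq0 k : (0 < k)%N -> P k != 0.
Proof. by move=> k0; rewrite -size_poly_gt0 size_pathp. Qed.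

Lemma pos_pathp k : (0 < k)%N -> pos_poly (P k).
Proof.
case: k => // k _; elim: k => [|k IH]; first by rewrite /pos_poly lead_coef1.
rewrite pathpSS; apply: pos_polyDl; first by rewrite pos_polyM // /pos_poly lead_coefX.
by rewrite size_polyN size_pathp mulrC size_mulX ?size_pathp ?pathp_neq0.
Qed.

(** With t = s + 2, all the polynomials of kites are divisible by (x + 1)^s;
this is the quotient.  Since s >= 1, a factor (x + 1)^s makes every nonzero
difference nonconstant. *)
Definition reduced_kite s k : {poly algC} :=
  linrec 'X ('X - s%:R) (('X - s.+1%:R) * ('X + 1)) k.

Lemma kite_poly_reduced s k : kite_poly s.+2 k = ('X + 1) ^+ s * reduced_kite s k.
Proof.
rewrite /kite_poly.
have -> : clique_poly s.+2.-1 = ('X + 1) ^+ s * ('X - s%:R).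
  by rewrite /clique_poly /=; poly_cring.
have -> : clique_poly s.+2 = ('X + 1) ^+ s * (('X - s.+1%:R) * ('X + 1)).
  by rewrite /clique_poly /= exprS; poly_cring.
elim/nat_ind2: k => [||k IH1 IH2] //; rewrite linrecSS IH1 IH2 /reduced_kite linrecSS;
  poly_cring.
Qed.

Lemma reduced_kite_monic_size s k : reduced_kite s k \is monic /\ size
  (reduced_kite s k) = k.+2.
Proof.
have mX c : 'X - c%:R \is @monic algC by rewrite -polyC_natr monicXsubC.
have sX c : size ('X - c%:R : {poly algC}) = 2 by rewrite -polyC_natr size_XsubC.
have mX1 : 'X + 1 \is @monic algC.
  by have := monicXsubC (-1 : algC); rewrite polyCN polyC1 opprK.
have sX1 : size ('X + 1 : {poly algC}) = 2.
  by have := size_XsubC (-1 : algC); rewrite polyCN polyC1 opprK.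
elim/nat_ind2: k => [||k [m1 s1] [m2 s2]]; first by rewrite /reduced_kite /= mX sX.
  by rewrite /reduced_kite /= monicMr // mX size_monicM ?sX ?sX1 // monic_neq0.
have h : size ('X * reduced_kite s k.+1) = k.+4.
  by rewrite mulrC size_mulX ?s2 // monic_neq0.
rewrite /reduced_kite linrecSS -!/(reduced_kite s _) size_polyDl ?size_polyN ?h ?s1 //;
  split=> //.
rewrite monicE lead_coefDl ?size_polyN ?h ?s1 // lead_coefM lead_coefX mul1r.
by rewrite (monicP m2).
Qed.

Lemma size_reduced_kite s k : size (reduced_kite s k) = k.+2.
Proof. by case: (reduced_kite_monic_size s k). Qed.

Lemma pos_reduced_kite s k : pos_poly (reduced_kite s k).
Proof. by case: (reduced_kite_monic_size s k) => m _; apply: monic_pos_poly. Qed.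

Lemma reduced_kite0 s : reduced_kite s 0 = 'X - s%:R. Proof. by []. Qed.

(** The kite sequence continued to the left of index 0 takes the value s + 1,
which is the quotient of Q_(-2) by (x + 1)^s. *)
Lemma reduced_kite1 s : reduced_kite s 1 = 'X * reduced_kite s 0 - s.+1%:R.
Proof. by rewrite /reduced_kite /=; poly_cring. Qed.

Lemma reduced_kiteE s k : reduced_kite s k = P k.+1 * reduced_kite s 0 - P k * s.+1%:R.
Proof.
case: k => [|k]; first by rewrite /pathp /= mul1r mul0r subr0.
rewrite /reduced_kite linrec_pathp /= (pathpSS _ k); poly_cring.
Qed.

Definition reduced_branch s a b j : {poly algC} :=
  P a.+1 * reduced_kite s (j + b).+1 - P a * P b.+1 * reduced_kite s j.

Lemma branch_poly_reduced s a b j : branch_poly s.+2 a b j = ('X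
  + 1) ^+ s * reduced_branch s a b j.
Proof. by rewrite /branch_poly !kite_poly_reduced /reduced_branch; poly_cring. Qed.

Lemma pathp_cassini k l : P k.+1 * P (l + k) - P k * P (l + k).+1 = P l.
Proof. exact: linrec_cassini. Qed.

Lemma pathp_add k l : P (k + l).+1 = P k.+1 * P l.+1 - P k * P l.
Proof. exact: linrec_add. Qed.

Lemma reduced_kite_cassini s k l :
  P k.+1 * reduced_kite s (l + k) - P k * reduced_kite s (l + k).+1 = reduced_kite s l.
Proof. exact: linrec_cassini. Qed.

Lemma reduced_kite_add s k l : reduced_kite s (k + l).+1 = P k.+1 * reduced_kite s l.+1
  - P k * reduced_kite s l.
Proof. exact: linrec_add. Qed.

(** The left-hand side is invariant under a simultaneous shift of both indices;
the right-hand side is its value at c = 0. *)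
Lemma reduced_kite_casoratian s c d :
  P (d + c).+2 * reduced_kite s c - P (d + c).+1 * reduced_kite s c.+1 =
  s.+1%:R * P d.+1 - P d * reduced_kite s 0.
Proof.
elim: c => [|c IH].
  by rewrite addn0 reduced_kite1 (pathpSS _ d); poly_cring.
by rewrite !addnS (pathpSS _ (d
  + c).+1) /reduced_kite linrecSS -!/(reduced_kite s _) -IH; poly_cring.
Qed.

(** Shifting both indices down to zero leaves a kite polynomial when b < c.
When c <= b it leaves s P_(d+1) plus terms of lower degree, or the constant
s + 1; this is where t >= 3 is needed. *)
Lemma reduced_kite_casoratian_pos s b c : (0 < s)%N ->
  pos_poly (P b.+2 * reduced_kite s c - P b.+1 * reduced_kite s c.+1).
Proof.
move=> s0; case: (leqP c b) => [cb|bc]; last first.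
  have -> : c = (c - b.+1 + b.+1)%N by lia.
  by rewrite reduced_kite_cassini pos_reduced_kite.
have -> : b = ((b - c) + c)%N by lia.
rewrite reduced_kite_casoratian; case: (b - c)%N => [|d].
  rewrite /pathp /= mul0r subr0; apply: pos_poly_natM => //.
  by rewrite /pos_poly lead_coef1.
have -> : s.+1%:R * P d.+2 - P d.+1 * reduced_kite s 0 = s%:R * P d.+2 + (s%:R * P d.+1
  - P d).
  by rewrite (pathpSS _ d) reduced_kite0 -[s.+1]addn1 natrD; poly_cring.
apply: pos_polyDl; first by rewrite pos_poly_natM ?pos_pathp.
have -> : size (s%:R * P d.+2) = d.+2.
  by rewrite mulr_natl -scaler_nat size_scale ?size_pathp // pnatr_eq0 -lt0n.
rewrite ltnS (leq_trans (size_polyD _ _)) // geq_max size_polyN.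
by rewrite (leq_trans (size_natM_le _ _)) size_pathp //=.
Qed.

Lemma ncpos_X1 s (p : {poly algC}) : (0 < s)%N -> pos_poly p ->
  ncpos_poly (('X + 1) ^+ s * p).
Proof.
move=> s0; apply: ncpos_polyM; rewrite /ncpos_poly.
have -> : 'X + 1 = 'X - (-1)%:P :> {poly algC} by rewrite polyCN polyC1 opprK.
rewrite size_exp_XsubC ltnS s0 /=; apply: monic_pos_poly.
by rewrite monic_exp ?monicXsubC.
Qed.

(** Only the second term of phi changes, since j + b is fixed. *)
Lemma branch_towards_clique t a b j : (2 < t)%N -> (0 < a)%N ->
  ncpos_poly (branch_poly t a b j.+1 - branch_poly t a b.+1 j).
Proof.
case: t => [|[|s]] // s0 a0; rewrite !branch_poly_reduced -mulrBr; apply: ncpos_X1 => //.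
have -> : reduced_branch s a b j.+1 - reduced_branch s a b.+1 j =
   P a * (P b.+2 * reduced_kite s j - P b.+1 * reduced_kite s j.+1).
  by rewrite /reduced_branch addSn addnS; poly_cring.
by rewrite pos_polyM ?pos_pathp ?reduced_kite_casoratian_pos.
Qed.

(** The difference is P_e Q_(j-2). *)
Lemma balance_arms t a e j : (2 < t)%N -> (0 < j)%N ->
  ncpos_poly (branch_poly t a (a + e).+2 j - branch_poly t a.+1 (a + e).+1 j).
Proof.
case: t => [|[|s]] // s0; case: j => // j _.
rewrite !branch_poly_reduced -mulrBr; apply: ncpos_X1 => //.
have -> : reduced_branch s a (a + e).+2 j.+1 - reduced_branch s a.+1 (a + e).+1 j.+1 =
   P e.+1 * reduced_kite s j.
  have := pathp_cassini a.+1 e.+1; rewrite -addSnnS (addnC e.+2) => <-.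
  rewrite /reduced_branch; set b := (a + e)%N.
  have -> : (a + e.+2 = b.+2)%N by rewrite /b; lia.
  have -> : (j.+1 + b.+2 = b.+3 + j)%N by lia.
  have -> : (j.+1 + b.+1 = b.+2 + j)%N by lia.
  by rewrite !reduced_kite_add (pathpSS _ b.+2) (pathpSS _ a); poly_cring.
by rewrite pos_polyM ?pos_pathp ?pos_reduced_kite.
Qed.

(** With B = i + e + 3, the difference is P_i Q_e - P_(i-1) P_(e+1) Q_(-2); the
first term has degree two more than the second. *)
Lemma lengthen_short_arm t i e : (2 < t)%N ->
  ncpos_poly (branch_poly t i (i + e).+3 i.+1 - branch_poly t i.+1 i.+1 (i + e).+2).
Proof.
case: t => [|[|s]] // s0.
rewrite !branch_poly_reduced -mulrBr; apply: ncpos_X1 => //.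
have -> : reduced_branch s i (i + e).+3 i.+1 - reduced_branch s i.+1 i.+1 (i + e).+2 =
   P i.+1 * reduced_kite s e.+1 - s.+1%:R * (P i * P e.+2).
  rewrite /reduced_branch.
  have h1 : P i.+2 * reduced_kite s (i.+1 + (i + e).+3)
      - P i.+1 * reduced_kite s (i.+1 + (i + e).+3).+1
      = reduced_kite s (i + e).+3.
    have -> : (i.+1 + (i + e).+3 = (i + e).+3 + i.+1)%N by lia.
    exact: reduced_kite_cassini.
  have h2 : P (i + e).+4 * reduced_kite s i.+1 = P i.+2 * reduced_kite s (i + e).+3
    + P e.+2 * s.+1%:R.
    have -> : s.+1%:R = P i.+3 * reduced_kite s i.+1 - P i.+2 * reduced_kite s i.+2.
      by have := reduced_kite_casoratian s i.+1 0; rewrite add0n => ->;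
        rewrite /pathp /=; poly_cring.
    have -> : ((i + e).+4 = (i.+1 + e.+2).+1)%N by lia.
    have -> : ((i + e).+3 = (e.+1 + i.+1).+1)%N by lia.
    by rewrite pathp_add reduced_kite_add (pathpSS _ i.+1) (pathpSS _ e.+1); poly_cring.
  have h3 : P i.+1 * reduced_kite s (i + e).+2 - P i * reduced_kite s (i + e).+3 =
    reduced_kite s e.+2.
    have := reduced_kite_cassini s i e.+2.
    by have -> : (e.+2 + i = (i + e).+2)%N by lia.
  have h4 : reduced_kite s (i + e).+3 = P i.+2 * reduced_kite s e.+2
    - P i.+1 * reduced_kite s e.+1.
    rewrite -reduced_kite_add; congr reduced_kite; lia.
  have -> : ((i + e).+2 + i.+1 = i.+1 + (i + e).+2)%N by lia.
  have -> : ((i.+1 + (i + e).+2).+1 = i.+1 + (i + e).+3)%N by lia.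
  transitivity (- reduced_kite s (i + e).+3 - P i * (P (i + e).+4 * reduced_kite s i.+1)
     + P i.+1 * P i.+2 * reduced_kite s (i + e).+2); first by rewrite -h1; poly_cring.
  rewrite h2; transitivity (P i.+2 * (P i.+1 * reduced_kite s (i + e).+2
    - P i * reduced_kite s (i + e).+3)
     - reduced_kite s (i + e).+3 - s.+1%:R * (P i * P e.+2)); first by poly_cring.
  by rewrite h3 h4; poly_cring.
apply: pos_polyDl; first by rewrite pos_polyM ?pos_pathp ?pos_reduced_kite.
rewrite size_polyN [X in (_ < X)%N]size_mul ?pathp_neq0 ?(pos_poly_neq0
  (pos_reduced_kite _ _)) //.
rewrite size_reduced_kite size_pathp.
rewrite (leq_ltn_trans (size_natM_le _ _)) // (leq_ltn_trans (size_polyMleq _ _)) //.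
by rewrite !size_pathp; lia.
Qed.

(** Here the branching vertex has the same distance to the clique and to the
nearest leaf, so that the effects of the two ends have opposite signs and
the same order.  Up to the factor (x + 1)^s, the difference is (s - 1) x
P_(e+2) P_(i-1), plus s times a sum of two path products of degree one less,
plus a term of lower degree: for t = 3 the first term vanishes and the
second decides. *)
Lemma shorten_equal_arms t i e : (2 < t)%N -> (0 < i)%N ->
  ncpos_poly (branch_poly t i.+1 (i + e).+2 i.+1 - branch_poly t i (i + e).+4 i).
Proof.
case: t => [|[|s]] // s0 i0.
rewrite !branch_poly_reduced -mulrBr; apply: ncpos_X1 => //.
have -> : reduced_branch s i.+1 (i + e).+2 i.+1 - reduced_branch s i (i + e).+4 i =
  s%:R * ('X + 1) * (P e.+3 * P i) - P i.+1 * P e.+2 * reduced_kite s 0.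
  rewrite /reduced_branch.
  have -> : (i + (i + e).+4).+1 = (i.+1 + (i + e).+2).+2 by lia.
  have h1 : P i.+2 * reduced_kite s (i.+1 + (i + e).+2).+1
      - P i.+1 * reduced_kite s (i.+1 + (i + e).+2).+2
      = reduced_kite s (i + e).+3.
    have -> : ((i.+1 + (i + e).+2).+1 = (i + e).+3 + i.+1)%N by lia.
    exact: reduced_kite_cassini.
  have cas : P i.+1 * P i.+1 - 'X * P i.+1 * P i + P i * P i = 1.
    have := pathp_cassini i 1; rewrite add1n (pathpSS _ i) => h.
    by rewrite -[RHS]/(P 1) -h; poly_cring.
  transitivity (reduced_kite s (i + e).+3 - P i.+1 * (P (i + e).+3 * reduced_kite s i.+1)
      + P i * (P (i + e).+4.+1 * reduced_kite s i)); first by rewrite -h1; poly_cring.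
  have -> : ((i + e).+4.+1 = (e.+4 + i).+1)%N by lia.
  have -> : ((i + e).+3 = (e.+2 + i).+1)%N by lia.
  rewrite reduced_kite_add !pathp_add (reduced_kiteE s i.+1) (reduced_kiteE s i).
  rewrite (pathpSS _ e.+3) (pathpSS _ e.+2) (pathpSS _ i).
  set K := reduced_kite s 0; set w : {poly algC} := s.+1%:R.
  have -> : s%:R * ('X + 1) = 'X * w - K.
    by rewrite /w /K reduced_kite0 -[s.+1]addn1 natrD; poly_cring.
  (* [L] is the part of degree one in P_(i-1) and P_i; the part of degree three is
     divisible by the Cassini form, which equals 1. *)
  move: cas; set A := P i; set A1 := P i.+1; set E2 := P e.+2; set E3 := P e.+3 => cas.
  set L := (X in X - A1 * _ + _); set T := (X in _ = X).
  transitivity (L + (A1 * A1 - 'X * A1 * A + A * A) * (T - L)).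
    by rewrite /L /T; poly_cring.
  by rewrite cas; poly_cring.
rewrite reduced_kite0.
have -> : s%:R * ('X + 1) * (P e.+3 * P i) - P i.+1 * P e.+2 * ('X - s%:R) =
   s.-1%:R * ('X * (P e.+3 * P i)) + (s%:R * (P e.+3 * P i + P i.+1 * P e.+2)
     + 'X * (P e.+3 * P i - P i.+1 * P e.+2)).
  by rewrite -[s in s%:R]prednK // -[s.-1.+1]addn1 natrD; poly_cring.
have p1 : pos_poly (P e.+3 * P i) by rewrite pos_polyM ?pos_pathp.
have p2 : pos_poly (P i.+1 * P e.+2) by rewrite pos_polyM ?pos_pathp.
have [p3 sz3] := pos_polyD p1 p2.
have sz : (size ('X * (P e.+3 * P i - P i.+1 * P e.+2))%R < i + e.+2)%N.
  have sX (p : {poly algC}) : (size ('X * p)%R <= (size p).+1)%N.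
    by rewrite (leq_trans (size_polyMleq _ _)) // size_polyX.
  case: i i0 {p1 p2 p3 sz3} => // i _; case: (leqP i e.+1) => ie.
    have := pathp_cassini i.+1 (e.+1 - i).
    have -> : (e.+1 - i + i.+1 = e.+2)%N by lia.
    move=> h; rewrite (_ : _ - _ = - P (e.+1 - i)); last by rewrite -h; poly_cring.
    by rewrite (leq_ltn_trans (sX _)) // size_polyN size_pathp; lia.
  have := pathp_cassini e.+2 (i - e.+1).
  have -> : (i - e.+1 + e.+2 = i.+1)%N by lia.
  move=> h; rewrite (_ : _ - _ = P (i - e.+1)); last by rewrite -h; poly_cring.
  by rewrite (leq_ltn_trans (sX _)) // size_pathp; lia.
have p4 : pos_poly (s%:R * (P e.+3 * P i + P i.+1 * P e.+2)
     + 'X * (P e.+3 * P i - P i.+1 * P e.+2)).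
  apply: pos_polyDl; first by rewrite pos_poly_natM.
  rewrite mulr_natl -scaler_nat size_scale ?pnatr_eq0 -?lt0n //.
  rewrite (leq_trans sz) // (leq_trans _ sz3) // size_mul ?pathp_neq0 // !size_pathp; lia.
case: (ltnP 0 s.-1) => [s1|]; last first.
  by rewrite leqn0 => /eqP ->; rewrite mul0r add0r.
have p5 : pos_poly (s.-1%:R * ('X * (P e.+3 * P i))).
  by rewrite pos_poly_natM // pos_polyM // /pos_poly lead_coefX.
by have [] := pos_polyD p5 p4.
Qed.

(** The difference is P_(a-1) times 2 P_(m+1) + P_m - x P_(m-1), and the last
two terms have degree at most m. *)
Lemma split_attachment a m : (0 < a)%N ->
  ncpos_poly (branch_poly 3 a m.+1 1 - two_path_poly a m.+2).
Proof.
move=> a0.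
have -> : branch_poly 3 a m.+1 1 - two_path_poly a m.+2 =
   (2%:R * P m.+2 + (P m.+1 - 'X * P m)) * P a.
  rewrite /branch_poly /two_path_poly add1n.
  have -> : kite_poly 3 1 = ('X - 2%:R) * ('X + 1) * ('X + 1).
    by rewrite kite_poly_reduced expr1 /reduced_kite /=; poly_cring.
  rewrite (pathpSS _ m.+3) (pathpSS _ m.+2) (pathpSS _ m.+1) (pathpSS _ m); poly_cring.
apply: ncpos_polyM; last exact: pos_pathp.
have sz2 : size (2%:R * P m.+2) = m.+2.
  by rewrite mulr_natl -scaler_nat size_scale ?pnatr_eq0 // size_pathp.
have szlt : (size (P m.+1 - 'X * P m)%R < size (2%:R * P m.+2)%R)%N.
  rewrite sz2 ltnS (leq_trans (size_polyD _ _)) // geq_max size_polyN size_pathp leqnn /=.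
  by rewrite (leq_trans (size_polyMleq _ _)) // size_polyX size_pathp.
rewrite /ncpos_poly size_polyDl // sz2 /=.
by apply: pos_polyDl => //; rewrite pos_poly_natM ?pos_pathp.
Qed.
End Comparisons.

(** * The order on the parameters of the graphs with one branching vertex *)

Section ParameterOrder.
Variables (t d : nat).
Hypothesis t2 : (2 < t)%N.

Definition poly_before (p q : {poly algC}) := ncpos_poly (p - q).
Definition poly_before_eq p q := p = q \/ poly_before p q.

Lemma poly_before_trans p q r : poly_before p q -> poly_before q r -> poly_before p r.
Proof. by rewrite /poly_before => pq qr; rewrite -[p](subrK q) -addrA ncpos_polyD. Qed.

Lemma poly_before_before_eq p q r : poly_before p q -> poly_before_eq q r ->
  poly_before p r.
Proof. by move=> pq [<-|] //; apply: poly_before_trans. Qed.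

Lemma poly_before_eq_trans p q r : poly_before_eq p q -> poly_before_eq q r ->
  poly_before_eq p r.
Proof. by move=> [->|pq] // qr; right; apply: poly_before_before_eq qr. Qed.

(** The two pendant paths play the same role, which the formula hides. *)
Lemma branch_polyC a b j : branch_poly t a b j = branch_poly t b a j.
Proof.
rewrite /branch_poly (addnC j b)
  (addnC j a) /kite_poly !linrec_add -/(kite_poly t j) -/(kite_poly t j.+1); poly_cring.
Qed.

(** The characteristic polynomial of G_j^i, with d = n - t. *)
Definition kite_branch_poly i j := branch_poly t i (d - i - j) j.

Lemma kite_branch_poly_decr i j : (0 < i)%N -> (i + j.+1 <= d)%N ->
  poly_before (kite_branch_poly i j.+1) (kite_branch_poly i j).
Proof.
move=> i0 hd; rewrite /kite_branch_poly; have -> : (d - i - j = (d - i - j.+1).+1)%N by lia.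
exact: branch_towards_clique.
Qed.

Lemma kite_before_first_branch b j : (2 < d)%N -> (b + j = d)%N ->
  poly_before (branch_poly t 0 b j) (kite_branch_poly 1 (d - 2)).
Proof.
move=> d2 bjd; have -> : branch_poly t 0 b j = branch_poly t 0 2 (d - 2).
  rewrite /branch_poly; have -> : pathp ('X : {poly algC}) 0 = 0 by [].
  by rewrite !mul0r; have -> : (d - 2 + 2 = j + b)%N by lia.
rewrite /kite_branch_poly; have -> : (d - 1 - (d - 2) = 1)%N by lia.
have := @balance_arms t 0 0 (d - 2) t2; apply; lia.
Qed.

Lemma kite_branch_poly_next i : (3 * i + 4 <= d)%N -> poly_before
  (kite_branch_poly i i.+1) (kite_branch_poly i.+1 (d - 2 * i.+1)).
Proof.
move=> hd; have := @lengthen_short_arm t i (d - (3 * i + 4)) t2.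
rewrite /poly_before /kite_branch_poly.
have -> : (d - i - i.+1 = (i + (d - (3 * i + 4))).+3)%N by lia.
have -> : (d - i.+1 - (d - 2 * i.+1) = i.+1)%N by lia.
by have -> : (d - 2 * i.+1 = (i + (d - (3 * i + 4))).+2)%N by lia.
Qed.

Lemma balance_arms_chain a k b j : (0 < j)%N -> (a + k <= b)%N ->
  poly_before_eq (branch_poly t a (b + k) j) (branch_poly t (a + k) b j).
Proof.
move=> j0; elim: k a => [|k IH] a hk; first by left; rewrite !addn0.
rewrite -(addSnnS a); apply: poly_before_eq_trans (IH a.+1 _); last lia.
right; have := @balance_arms t a (b + k.+1 - a.+2) j t2 j0.
have -> : ((a + (b + k.+1 - a.+2)).+2 = b + k.+1)%N by lia.
by have -> : ((a + (b + k.+1 - a.+2)).+1 = b + k)%N by lia.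
Qed.

Lemma shorten_equal_arms_chain i k : (0 < i)%N -> (3 * (i + k) <= d)%N ->
  (k = 0 \/ 3 * (i + k) < d)%N ->
  poly_before_eq (branch_poly t (i + k) (d - 2 * (i + k)) (i + k)) (branch_poly t i (d
    - 2 * i) i).
Proof.
move=> i0; elim: k => [|k IH] h1 h2; first by left; rewrite addn0.
apply: poly_before_eq_trans (IH _ _); [|lia|lia].
right; rewrite addnS; set l := (i + k)%N.
have := @shorten_equal_arms t l (d - (3 * l + 4)) t2.
have -> : ((l + (d - (3 * l + 4))).+4 = d - 2 * l)%N by lia.
have -> : ((l + (d - (3 * l + 4))).+2 = d - 2 * l.+1)%N by lia.
by apply; lia.
Qed.

(** If j <= m, move the branching vertex of the last listed graph one step
towards the clique, then shorten both short ends until they have length j,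
then balance the pendant paths.  Otherwise d = 3(m + 1) and i = j = m + 1,
and balancing once suffices. *)
Lemma last_listed_before m i j : (3 < d)%N -> m = ((d - 1) %/ 3)%N ->
  (0 < j <= i)%N -> (i + j <= d)%N -> (i <= d - i - j)%N ->
  poly_before (kite_branch_poly m m.+1) (kite_branch_poly i j).
Proof.
move=> d3 hm /andP[j0 ji] ijd ib.
have m0 : (0 < m)%N by lia.
case: (leqP j m) => jm.
  apply: (@poly_before_before_eq _ (kite_branch_poly m m));
    first by apply: kite_branch_poly_decr => //; lia.
  apply: (@poly_before_eq_trans _ (kite_branch_poly j j)).
    have := @shorten_equal_arms_chain j (m - j) j0; rewrite subnKC // /kite_branch_poly.
    have -> : (d - m - m = d - 2 * m)%N by lia.
    have -> : (d - j - j = d - 2 * j)%N by lia.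
    by apply; lia.
  have := @balance_arms_chain j (i - j) (d - i - j) j j0; rewrite subnKC
    // /kite_branch_poly.
  have -> : (d - i - j + (i - j) = d - j - j)%N by lia.
  by apply; lia.
have [-> -> dE] : [/\ j = m.+1, i = m.+1 & d = (3 * m.+1)%N] by split; lia.
have := @balance_arms t m 0 m.+1 t2 isT; rewrite addn0 /kite_branch_poly.
have -> : (d - m - m.+1 = m.+2)%N by lia.
by have -> : (d - m.+1 - m.+1 = m.+1)%N by lia.
Qed.

Lemma last_listed_before_arms m a b j : (3 < d)%N -> m = ((d - 1) %/ 3)%N ->
  (0 < j <= a)%N -> (j <= b)%N -> (j + a + b = d)%N ->
  poly_before (kite_branch_poly m m.+1) (branch_poly t a b j).
Proof.
move=> d3 hm h1 h2 h3; case: (leqP a b) => ab.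
  have -> : b = (d - a - j)%N by lia.
  by apply: last_listed_before => //; lia.
rewrite branch_polyC; have -> : a = (d - b - j)%N by lia.
by apply: last_listed_before => //; lia.
Qed.

End ParameterOrder.

Lemma two_path_polyC a b : two_path_poly a b = two_path_poly b a.
Proof.
have Kc c : kite_poly 3 c.+1 = pathp 'X c.+1 * kite_poly 3 1 - pathp 'X c * kite_poly 3 0.
  by rewrite /kite_poly linrec_pathp.
have K0 : kite_poly 3 0 = 'X * 'X
  - 1 by rewrite kite_poly_reduced expr1 /reduced_kite /=; poly_cring.
rewrite /two_path_poly (Kc a)
  (Kc b) K0 !(pathpSS _ b.+1) !(pathpSS _ b) !(pathpSS _ a.+1) !(pathpSS _ a).
move: (kite_poly 3 1) (pathp _ a) (pathp _ a.+1) (pathp _ b) (pathp _ b.+1) => K A A1 B B1.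
poly_cring.
Qed.

(** By symmetry b >= 2, and the triangle is then compared with the graph that
has its branching vertex at distance 1 from the clique. *)
Lemma last_listed_before_triangle m d a b : (3 < d)%N -> m = ((d - 1) %/ 3)%N ->
  (0 < a)%N -> (0 < b)%N -> (a + b = d)%N ->
  poly_before (kite_branch_poly 3 d m m.+1) (two_path_poly a b).
Proof.
move=> d3 hm; wlog b2 : a b / (1 < b)%N => [hw a0 b0 abd|a0 _ abd].
  case: (ltnP 1 b) => b1; first exact: hw.
  by rewrite two_path_polyC; apply: hw => //; lia.
case: b b2 abd => [|[|b]] // _ abd; apply: poly_before_trans (split_attachment b a0).
by apply: last_listed_before_arms => //; lia.
Qed.

(** * Closed walks of length at most four *)

Local Close Scope ring_scope.

Section WalkCounts.
Variable g : rel nat.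

Definition deg_n n u := \sum_(b < n) g u b.
Definition codeg_n n a c := \sum_(b < n) (g a b && g b c).
Definition walks2 n := \sum_(a < n) deg_n n a.
Definition walks3 n := \sum_(a < n) \sum_(c < n) g a c * codeg_n n a c.
Definition walks4 n := \sum_(a < n) \sum_(c < n) codeg_n n a c ^ 2.

Hypothesis g_sym : symmetric g.
Variables n u : nat.
Hypothesis un : u < n.
Hypothesis leaf_loop : g n n = false.
Hypothesis leaf_row : forall k, k < n -> g n k = (k == u).

Lemma leaf_col k : k < n -> g k n = (k == u).
Proof. by move=> kn; rewrite g_sym leaf_row. Qed.

Lemma sum_pick (F : nat -> nat) : \sum_(k < n) (val k == u) * F k = F u.
Proof.
rewrite (bigD1 (Ordinal un)) //= eqxx mul1n big1 ?addn0 // => i.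
by rewrite -val_eqE /= => /negPf ->.
Qed.

Lemma sum_pick1 : \sum_(k < n) (val k == u) = 1.
Proof.
rewrite -[RHS](sum_pick (fun=> 1)); apply: eq_bigr => i _; by rewrite muln1.
Qed.

Lemma deg_n_old v : v < n -> deg_n n.+1 v = deg_n n v + (v == u).
Proof. by move=> vn; rewrite /deg_n big_ord_recr /= leaf_col. Qed.

Lemma deg_n_new : deg_n n.+1 n = 1.
Proof.
rewrite /deg_n big_ord_recr /= leaf_loop addn0 -[RHS]sum_pick1.
by apply: eq_bigr => i _; rewrite leaf_row.
Qed.

Lemma walks2_leaf : walks2 n.+1 = walks2 n + 2.
Proof.
rewrite /walks2 big_ord_recr /= deg_n_new (eq_bigr (fun i : 'I_n =>
  deg_n n i + (val i == u))).
  by rewrite big_split /= sum_pick1 -addnA.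
by move=> i _; rewrite deg_n_old.
Qed.

Lemma codeg_old a c : a < n -> c < n ->
  codeg_n n.+1 a c = codeg_n n a c + (a == u) * (c == u).
Proof. by move=> an cn; rewrite /codeg_n big_ord_recr /= leaf_col // leaf_row // mulnb. Qed.

Lemma codeg_old_new a : a < n -> codeg_n n.+1 a n = g a u.
Proof.
move=> an; rewrite /codeg_n big_ord_recr /= leaf_loop andbF addn0.
rewrite -[RHS](sum_pick (fun k => g a k)); apply: eq_bigr => i _.
by rewrite leaf_col // mulnb andbC.
Qed.

Lemma codeg_new_old c : c < n -> codeg_n n.+1 n c = g u c.
Proof.
move=> an; rewrite /codeg_n big_ord_recr /= leaf_loop addn0.
rewrite -[RHS](sum_pick (fun k => g k c)); apply: eq_bigr => i _.
by rewrite leaf_row // mulnb.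
Qed.

Lemma codeg_new : codeg_n n.+1 n n = 1.
Proof.
rewrite /codeg_n big_ord_recr /= leaf_loop addn0 -[RHS]sum_pick1.
by apply: eq_bigr => i _; rewrite leaf_row // leaf_col // andbb.
Qed.

Lemma codeg_diag a : codeg_n n a a = deg_n n a.
Proof. by apply: eq_bigr => i _; rewrite [g i a]g_sym andbb. Qed.

Lemma walks3_leaf : g u u = false -> walks3 n.+1 = walks3 n.
Proof.
move=> guu; rewrite /walks3 big_ord_recr /= [X in _
  + X]big_ord_recr /= leaf_loop mul0n addn0.
rewrite [X in _ + X]big1 ?addn0 => [|c _]; last first.
  by rewrite leaf_row // codeg_new_old // mulnb; case: eqP => //= ->; rewrite guu.
apply: eq_bigr => a _; rewrite big_ord_recr /=.
rewrite leaf_col // codeg_old_new // (_ : (val a == u) * g a u = 0) ?addn0; last first.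
  by rewrite mulnb; case: eqP => //= ->; rewrite guu.
apply: eq_bigr => c _; rewrite codeg_old //.
case: (val a =P u) => [->|_]; last by rewrite addn0.
by case: (val c =P u) => [->|_]; rewrite ?guu ?mul0n ?muln0 ?addn0.
Qed.

(** Of the new closed walks of length four, two only use the new edge, and four
go through each edge at [u] that was there before. *)
Lemma walks4_leaf : walks4 n.+1 = walks4 n + (4 * deg_n n u + 2).
Proof.
rewrite /walks4 big_ord_recr /= [X in _ + X]big_ord_recr /= codeg_new.
have -> : \sum_(c < n) codeg_n n.+1 n c ^ 2 = deg_n n u.
  by apply: eq_bigr => c _; rewrite codeg_new_old //; case: (g u c).
have -> : \sum_(a < n) \sum_(c < n.+1) codeg_n n.+1 a c ^ 2 =
  walks4 n + (2 * deg_n n u + 1) + deg_n n u.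
  rewrite (eq_bigr (fun a : 'I_n => (\sum_(c < n) codeg_n n a c ^ 2
     + (val a == u) * (2 * deg_n n a + 1)) + g u a)).
    by rewrite !big_split /= (sum_pick (fun a => 2 * deg_n n a + 1)).
  move=> a _; rewrite big_ord_recr /= codeg_old_new // g_sym.
  congr (_ + _); last by case: (g u a).
  rewrite (eq_bigr (fun c : 'I_n => codeg_n n a c ^ 2
     + (val c == u) * ((val a == u) * (2 * codeg_n n a c + 1)))); last first.
    move=> c _; rewrite codeg_old //; case: (val a == u); case: (val c == u);
    rewrite ?mul0n ?mul1n ?addn0 //; nia.
  rewrite big_split /=; congr (_ + _).
  rewrite (sum_pick (fun c => (val a == u) * (2 * codeg_n n a c + 1))).
  by case: (val a =P u) => [<-|]; rewrite ?mul0n // codeg_diag.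
rewrite -/(walks4 n) exp1n; lia.
Qed.

End WalkCounts.

Section PtreeWalks.
Variables (t : nat) (f : nat -> nat).
Local Notation g := (ptree t f).

Definition attach_deg x := deg_n g x (f x).
Definition children x v := \sum_(t <= y < x) (f y == v).

Lemma ptree_irr x : g x x = false.
Proof. by rewrite /ptree eqxx. Qed.

Lemma walks2_ptree n : parents t f n -> t <= n -> walks2 g n = walks2 g t + 2 * (n - t).
Proof.
elim: n => [|n IH] pf; first by rewrite leqn0 => /eqP ->; rewrite addn0.
rewrite leq_eqVlt => /predU1P[<-|tn]; first by rewrite subnn addn0.
rewrite (@walks2_leaf _ (ptree_sym t f) n (f n)) ?ptree_irr //; last first.
- by move=> k kn; apply: ptree_leaf.
- by apply: pf; rewrite ltnSn andbT.
rewrite IH //; [lia | exact: parentsW pf].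
Qed.

Lemma walks3_ptree n : parents t f n -> t <= n -> walks3 g n = walks3 g t.
Proof.
elim: n => [|n IH] pf; first by rewrite leqn0 => /eqP ->.
rewrite leq_eqVlt => /predU1P[<-//|tn].
rewrite (@walks3_leaf _ (ptree_sym t f) n (f n)) ?ptree_irr //; last first.
- by move=> k kn; apply: ptree_leaf.
- by apply: pf; rewrite ltnSn andbT.
rewrite IH //; exact: parentsW pf.
Qed.

Lemma walks4_ptree n : parents t f n -> t <= n ->
  walks4 g n = walks4 g t + 2 * (n - t) + 4 * \sum_(t <= x < n) attach_deg x.
Proof.
elim: n => [|n IH] pf; first by rewrite leqn0 => /eqP ->; rewrite big_geq // !addn0.
rewrite leq_eqVlt => /predU1P[<-|tn]; first by rewrite subnn big_geq // !addn0.
rewrite (@walks4_leaf _ (ptree_sym t f) n (f n)) ?ptree_irr //; last first.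
- by move=> k kn; apply: ptree_leaf.
- by apply: pf; rewrite ltnSn andbT.
rewrite IH //; last exact: parentsW pf.
by rewrite big_nat_recr //= /attach_deg; lia.
Qed.

Lemma deg_ptree n v : parents t f n -> t <= n -> v < n ->
  deg_n g n v = (if v < t then t.-1 else 1) + children n v.
Proof.
elim: n v => [|n IH] v pf //.
rewrite leq_eqVlt => /predU1P[<-|tn] vn.
  rewrite vn /children big_geq // addn0 /deg_n.
  rewrite (eq_bigr (fun b : 'I_t => (val b != v) : nat)); last first.
    by move=> b _; rewrite /ptree vn ltn_ord /= andbT eq_sym.
  have : \sum_(b < t) (val b == v) + \sum_(b < t) (val b != v) = t.
    rewrite -big_split /= (eq_bigr (fun=> 1)) ?sum_nat_const ?card_ord ?muln1 //.
    by move=> b _; case: eqP.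
  by rewrite sum_pick1 // add1n => /(congr1 predn).
rewrite /children big_nat_recr //= -/(children n v) addnA.
have fn : f n < n by apply: pf; rewrite ltnSn andbT.
have pf' : parents t f n by apply: parentsW pf.
have leaf_row k : k < n -> g n k = (k == f n) by move=> kn; apply: ptree_leaf.
move: vn; rewrite ltnS leq_eqVlt => /predU1P[->|vn].
  have c0 : children n n = 0.
    rewrite /children big_nat_cond big1 // => y /andP[/andP[ty yn] _].
    by rewrite ltn_eqF // (ltn_trans _ yn) // pf' // ty.
  have nt : (n < t) = false by apply/negbTE; rewrite -leqNgt.
  by rewrite (deg_n_new (u := f n)) ?ptree_irr // nt (ltn_eqF fn) c0.
by rewrite (deg_n_old (ptree_sym t f) leaf_row) // IH // [v == _]eq_sym.
Qed.

Lemma attach_degE x : parents t f x.+1 -> t <= x ->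
  attach_deg x = (if f x < t then t.-1 else 1) + children x (f x).
Proof.
move=> pf tx; rewrite /attach_deg deg_ptree //; first exact: parentsW pf.
by apply: pf; rewrite tx ltnSn.
Qed.
End PtreeWalks.

Lemma spectral_moment2_pgraph n t f :
  spectral_moment 2 (pgraph n t f) = (walks2 (ptree t f) n)%:R%R.
Proof.
rewrite spectral_moment2; congr (_%:R)%R; apply: eq_bigr => x _; apply: eq_bigr => y _.
by rewrite pgraphE.
Qed.

Lemma spectral_moment3_pgraph n t f :
  spectral_moment 3 (pgraph n t f) = (walks3 (ptree t f) n)%:R%R.
Proof.
rewrite spectral_moment3; congr (_%:R)%R; apply: eq_bigr => x _; apply: eq_bigr => y _.
by rewrite pgraphE; congr (_ * _); apply: eq_bigr => z _; rewrite !pgraphE.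
Qed.

Lemma spectral_moment4_pgraph n t f :
  spectral_moment 4 (pgraph n t f) = (walks4 (ptree t f) n)%:R%R.
Proof.
rewrite spectral_moment4; congr (_%:R)%R; apply: eq_bigr => x _; apply: eq_bigr => y _.
by congr (_ ^ 2); apply: eq_bigr => z _; rewrite !pgraphE.
Qed.

Lemma walks_clique t f f' :
  [/\ walks2 (ptree t f) t = walks2 (ptree t f') t,
      walks3 (ptree t f) t = walks3 (ptree t f') t
    & walks4 (ptree t f) t = walks4 (ptree t f') t].
Proof.
have e x y : x < t -> y < t -> ptree t f x y = ptree t f' x y.
  by move=> xt yt; rewrite /ptree xt yt !orTb.
have ec x y : x < t -> y < t -> codeg_n (ptree t f) t x y = codeg_n (ptree t f') t x y.
  by move=> xt yt; apply: eq_bigr => z _; rewrite !e.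
by split; apply: eq_bigr => x _; apply: eq_bigr => y _; rewrite ?ec ?e.
Qed.

Lemma spectral_moment2_parents n t f f' : t <= n -> parents t f n -> parents t f' n ->
  spectral_moment 2 (pgraph n t f) = spectral_moment 2 (pgraph n t f').
Proof.
move=> tn pf pf'; have [e _ _] := walks_clique t f f'.
by rewrite !spectral_moment2_pgraph (walks2_ptree pf tn) (walks2_ptree pf' tn) e.
Qed.

(** The fourth moment is an increasing function of the sum of the degrees at the
times of attachment, and the lower ones depend only on n and t. *)
Lemma S_before_attach_deg n t f f' : 4 < n -> t <= n -> parents t f n -> parents t f' n ->
  \sum_(t <= x < n) attach_deg t f x < \sum_(t <= x < n) attach_deg t f' x ->
  S_before (pgraph n t f) (pgraph n t f').
Proof.
move=> n4 tn pf pf' hlt; have [_ e3 e4] := walks_clique t f f'.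
apply: (S_before_first (k := 4)) => //; last first.
  by rewrite !spectral_moment4_pgraph (walks4_ptree pf tn)
    (walks4_ptree pf' tn) e4 ltr_nat ltn_add2l ltn_pmul2l.
case=> [|[|[|[|//]]]] _; rewrite ?spectral_moment0 ?spectral_moment1 //.
  exact: spectral_moment2_parents.
by rewrite !spectral_moment3_pgraph (walks3_ptree pf tn) (walks3_ptree pf' tn) e3.
Qed.

Lemma sum_near_min (a : nat -> nat) m n : m <= n -> (forall x, m <= x < n -> 1 <= a x) ->
  \sum_(m <= x < n) a x <= n - m + 1 ->
  (forall x, m <= x < n -> a x = 1) \/
  exists x0, [/\ m <= x0 < n, a x0 = 2 & forall x, m <= x < n -> x != x0 -> a x = 1].
Proof.
elim: n => [|n IH]; first by rewrite leqn0 => /eqP -> _ _; left=> x; rewrite ltn0 andbF.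
rewrite leq_eqVlt => /predU1P[-> _ _|mn ha].
  by left=> x /andP[h1 h2]; move: (leq_trans h2 h1); rewrite ltnn.
have lo : forall k, m <= k <= n -> k - m <= \sum_(m <= x < k) a x.
  elim=> [|k IHk] hk; first lia.
  case: (ltnP k m) => km; first lia.
  by rewrite big_nat_recr //=; have := IHk; have := ha k; lia.
rewrite big_nat_recr //= => hs; have an : 1 <= a n by apply: ha; lia.
have ln := lo n; case: (a n =P 1) => [an1|an1].
  case: IH => //; first by move=> x hx; apply: ha; lia.
  - lia.
  - move=> h; left=> x hx; case: (x =P n) => [-> //|?]; apply: h; lia.
  case=> x0 [h1 h2 h3]; right; exists x0; split=> //; first lia.
  move=> x hx xx; case: (x =P n) => [-> //|?]; apply: h3 => //; lia.
right; exists n; split; [lia | have := ln; lia |].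
move=> x hx xn; have xlt : x < n by move/eqP: xn; lia.
have : \sum_(m <= y < n) a y <= n - m by have := ln; lia.
rewrite (big_cat_nat _ (n := x.+1)) /=; [|lia|lia].
rewrite big_nat_recr /=; last lia.
have hi : n - x.+1 <= \sum_(x.+1 <= i < n) a i.
  rewrite -[n - _]muln1 -sum_nat_const_nat !big_nat; apply: leq_sum => i hi.
  apply: ha; lia.
have := lo x; have := ha x; lia.
Qed.

(** * Depth-first labellings *)

Section Ordering.
Variables (n t : nat) (G : sgraph n).
Hypotheses (t0 : 0 < t) (Gc : connected G).
Variable v0 : 'I_n.
Local Notation nthv l x := (nth v0 l x).

(** The last condition makes the order depth-first: an entry from t on that
still has neighbours to come is followed by one of them. *)
Definition search_order (l : seq 'I_n) :=
  [/\ uniq l, t <= size l,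
      forall x y, x < t -> y < t -> x != y -> G (nthv l x) (nthv l y),
      forall x, t <= x < size l -> exists2 y, y < x & G (nthv l y) (nthv l x)
    & forall x, t <= x -> x.+1 < size l -> G (nthv l x) (nthv l x.+1) \/
        forall v, v \notin take x.+1 l -> ~~ G (nthv l x) v].

Lemma search_order_rcons l v : search_order l -> v \notin l ->
  (exists2 y, y < size l & G (nthv l y) v) ->
  (t < size l -> G (nthv l (size l).-1) v \/
     forall w, w \notin l -> ~~ G (nthv l (size l).-1) w) ->
  search_order (rcons l v).
Proof.
move=> [ul tl cl pl dl] vl [y yl Gy] last_l.
have nthr x : x < size l -> nthv (rcons l v) x = nthv l x by move=> xl;
  rewrite nth_rcons xl.
have nthl : nthv (rcons l v) (size l) = v by rewrite nth_rcons ltnn eqxx.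
rewrite /search_order size_rcons rcons_uniq vl ul; split=> //.
- exact: leqW.
- by move=> x z xt zt; rewrite !nthr ?(leq_trans _ tl) //; apply: cl.
- move=> x /andP[tx]; rewrite ltnS leq_eqVlt => /predU1P[->|xl].
    by exists y; rewrite ?nthl ?nthr.
  have [|z zx Gz] := pl x; first by rewrite tx.
  by exists z; rewrite ?nthr // (ltn_trans zx).
- move=> x tx; rewrite ltnS leq_eqVlt => /predU1P[xl|xl].
    rewrite xl nthl nthr -?xl // -cats1 take_cat -xl ltnn subnn take0 cats0.
    by move: last_l; rewrite -xl => /(_ tx).
  rewrite !nthr // ?(ltnW xl) //; have [|h] := dl x tx xl; first by left.
  by right=> w; rewrite -cats1 takel_cat; [apply: h | apply: ltnW].
Qed.

(** Prefer a neighbour of the last entry; if there is none, connectedness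
provides an edge that leaves the sequence. *)
Lemma search_order_extend l : search_order l -> size l < n ->
  exists v, search_order (rcons l v).
Proof.
move=> so ln; have [ul tl _ _ _] := so.
have l0 : 0 < size l by apply: leq_trans tl.
pose z := nthv l (size l).-1.
case: (boolP [exists v, (v \notin l) && G z v]) => [/existsP[v /andP[vl Gz]]|nz].
  exists v; apply: search_order_rcons => //; last by left.
  by exists (size l).-1; rewrite ?prednK.
have [w wl] : exists w, w \notin l.
  apply/existsP; rewrite -[X in is_true X]negbK negb_exists.
  apply/negP => /forallP all_l; move: ln;
    rewrite -(card_uniqP ul) -[X in _ < X]card_ord ltnNge.
  by rewrite subset_leq_card //; apply/subsetP => w _; have := all_l w; rewrite negbK.
have [y [v [yl vl Gy]]] : exists y v, [/\ y \in l, v \notin l & G y v].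
  case: (boolP [exists y, [exists v, [&& y \in l, v \notin l & G y v]]]) => [|ne].
    by move=> /existsP[y /existsP[v /and3P[]]]; exists y, v.
  have cl : closed G (mem l).
    have half x y : G x y -> x \in l -> y \in l.
      move=> Gxy xl; apply: contraR ne => yl.
      by apply/existsP; exists x; apply/existsP; exists y; rewrite xl yl.
    move=> x y Gxy; apply/idP/idP; first exact: half.
    by apply: half; rewrite adj_sym.
  have h0 : nthv l 0 \in l by apply: mem_nth.
  have := closed_connect cl (forallP (forallP Gc (nthv l 0)) w).
  by rewrite h0 (negPf wl).
exists v; apply: search_order_rcons => //.
  by exists (index y l); rewrite ?index_mem ?nth_index.
move=> _; right=> u ul'; apply: contra nz => Gu.
by apply/existsP; exists u; rewrite ul'.
Qed.

Lemma search_order_exists (A : {set 'I_n}) : is_clique G A -> #|A| = t ->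
  exists2 l, search_order l & size l = n.
Proof.
move=> /forallP Acl At; suff: forall k, t <= k <= n ->
  exists2 l, search_order l & size l = k.
  apply; rewrite leqnn andbT -At; apply: leq_trans (max_card _) _; by rewrite card_ord.
elim=> [|k IH]; first by rewrite leqNgt t0.
rewrite leq_eqVlt => /andP[/predU1P[tk|tk] kn]; last first.
  have [|l so sl] := IH; first by rewrite -ltnS tk ltnW.
  have [|v sv] := search_order_extend so; first by rewrite sl.
  by exists (rcons l v); rewrite ?size_rcons ?sl.
have sz : size (enum A) = t by rewrite -cardE.
exists (enum A); last by rewrite sz.
split; rewrite ?enum_uniq ?sz //.
- move=> x y xt yt xy.
  have mA u : u < t -> nthv (enum A) u \in A.
    by move=> ut; rewrite -mem_enum mem_nth // sz.
  have := forallP (implyP (Acl (nthv (enum A) x)) (mA _ xt)) (nthv (enum A) y).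
  by rewrite mA //= nth_uniq ?enum_uniq ?sz // xy.
- by move=> x; case: ltngtP.
- by move=> x tx xt; move: (leq_trans xt tx); rewrite ltnNge leqnSn.
Qed.
End Ordering.

(** The third property is all that is needed of depth-first order. *)
Lemma search_labelling n t (G : sgraph n) : 0 < t -> in_L t G ->
  exists (s : 'S_n) (f : nat -> nat),
  [/\ parents t f n,
      forall x y : 'I_n, ptree t f x y -> G (s x) (s y)
    & forall x y z : 'I_n, t <= x -> x < y -> G (s x) (s y) -> z = x.+1 :> nat ->
        G (s x) (s z)].
Proof.
move=> t0 /andP[Gc /eqP cn].
have [A Acl At] : exists2 A, is_clique G A & #|A| = t.
  have c0 : is_clique G set0 by apply/forallP => x; rewrite inE.
  have [|A hA cA] := @eq_bigmax_cond _ (fun A => is_clique G A) (fun A => #|A|).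
    by apply/card_gt0P; exists set0.
  by exists A => //; rewrite -cA.
have [v0 _] : exists v0, v0 \in A by apply/card_gt0P; rewrite At.
have [l [ul tl cl pl dl] sl] := search_order_exists t0 Gc v0 Acl At.
have s_inj : injective (fun x : 'I_n => nth v0 l x).
  move=> x y /eqP; rewrite nth_uniq ?sl ?ltn_ord // => /eqP; exact: val_inj.
pose s := perm s_inj.
have sE x : s x = nth v0 l x by rewrite permE.
(* The parent is the earliest neighbour. *)
pose f x := find (fun v => G v (nth v0 l x)) l.
have pf x : t <= x < n -> f x < x /\ G (nth v0 l (f x)) (nth v0 l x).
  move=> hx; have [|y yx Gy] := pl x; first by rewrite sl.
  have yl : y < size l by rewrite sl; lia.
  split; last by apply: (@nth_find _ v0 (fun v => G v _)); apply/(has_nthP v0); exists y.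
  by apply: leq_ltn_trans yx; rewrite leqNgt; apply/negP => /(before_find v0); rewrite Gy.
exists s, f; split=> [x hx|x y|x y z tx xy Gxy zx].
- by have [] := pf x hx.
- rewrite /ptree !sE => /andP[xy] /or3P[/andP[xt yt]|/andP[tx /eqP ->]|/andP[ty /eqP ->]].
  + exact: cl.
  + by rewrite adj_sym; have [|_] := pf x; rewrite ?tx ?ltn_ord.
  + by have [|_] := pf y; rewrite ?ty ?ltn_ord.
- have zn := ltn_ord z; have yn := ltn_ord y.
  rewrite !sE zx; have [|//|h] := dl x tx; first by rewrite sl -zx.
  move: Gxy; rewrite !sE (negPf (h _ _)) //.
  by apply/negP => /index_ltn; rewrite index_uniq ?sl // ltnS leqNgt xy.
Qed.

(** * Graphs with few edges and small fourth moment *)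

Lemma isomorphicP n (G H : sgraph n) :
  reflect (exists s : 'S_n, forall x y, G x y = H (s x) (s y)) (isomorphic G H).
Proof.
apply: (iffP existsP) => -[s hs]; exists s.
  by move=> x y; apply/eqP; exact: (forallP (forallP hs x) y).
by apply/forallP => x; apply/forallP => y; rewrite hs.
Qed.

Lemma isomorphic_trans n (G H K : sgraph n) :
  isomorphic G H -> isomorphic H K -> isomorphic G K.
Proof.
move=> /isomorphicP[s hs] /isomorphicP[r hr]; apply/isomorphicP; exists (s * r)%g.
by move=> x y; rewrite hs hr !permM.
Qed.

Lemma isomorphic_eq n (G H : sgraph n) : (forall x y, G x y = H x y) -> isomorphic G H.
Proof. by move=> GH; apply/isomorphicP; exists 1%g => x y; rewrite !perm1. Qed.

Lemma char_poly_isomorphic n (G H : sgraph n) :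
  isomorphic G H -> char_poly (adjmx G) = char_poly (adjmx H).
Proof. by move=> /isomorphicP[s]; apply: char_poly_iso. Qed.

Lemma eq_pgraph n t f f' : (forall x, t <= x < n -> f x = f' x) ->
  isomorphic (pgraph n t f) (pgraph n t f').
Proof.
move=> ff; apply: isomorphic_eq => x y; rewrite !pgraphE /ptree.
congr (_ && [|| _ , _ | _]).
  by case tx: (t <= x) => //=; rewrite ff ?tx ?ltn_ord.
by case ty: (t <= y) => //=; rewrite ff ?ty ?ltn_ord.
Qed.

Lemma relabel_pgraph n t f f' (r : nat -> nat) :
  parents t f n ->
  (forall x, x < n -> r x < n) ->
  (forall x y, x < n -> y < n -> r x = r y -> x = y) ->
  (forall x, x < n -> (t <= r x) = (t <= x)) ->
  (forall x, t <= x < n -> f' (r x) = r (f x)) ->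
  isomorphic (pgraph n t f) (pgraph n t f').
Proof.
move=> pf rn rI rt rf.
have r_inj : injective (fun x : 'I_n => Ordinal (rn _ (ltn_ord x))).
  by move=> x y [/rI h]; apply: val_inj; apply: h.
have rE (x y : 'I_n) : (r x == r y) = (val x == val y).
  by apply/eqP/eqP => [/rI h|->] //; apply: h.
have rE' x y : x < n -> y < n -> (r x == r y) = (x == y).
  by move=> xn yn; apply/eqP/eqP => [/rI h|->] //; apply: h.
apply/isomorphicP; exists (perm r_inj) => x y; rewrite !pgraphE !permE /= /ptree.
rewrite rE' // !ltnNge !rt //; congr (_ && [|| _ , _ | _]).
  case tx: (t <= x) => //=; rewrite rf ?tx ?ltn_ord // rE' //.
  by apply: ltn_trans (ltn_ord x); apply: pf; rewrite tx ltn_ord.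
case ty: (t <= y) => //=; rewrite rf ?ty ?ltn_ord // rE' //.
by apply: ltn_trans (ltn_ord y); apply: pf; rewrite ty ltn_ord.
Qed.

Definition swapn p q x : nat := if x == p then q else if x == q then p else x.

Lemma swapn_neq p q x : x != p -> x != q -> swapn p q x = x.
Proof. by rewrite /swapn => /negPf -> /negPf ->. Qed.

Lemma swapnK p q : involutive (swapn p q).
Proof.
move=> x; rewrite /swapn; case: (x =P p) => [->|/eqP xp].
  by rewrite eqxx; case: (q =P p).
case: (x =P q) => [->|/eqP xq]; first by rewrite eqxx.
by rewrite (negPf xp) (negPf xq).
Qed.

(** The vertices of the clique are interchangeable: two of them can be
exchanged, which only changes the parents. *)
Lemma swap_clique n t f p q : t <= n -> parents t f n -> p < t -> q < t ->
  isomorphic (pgraph n t f) (pgraph n t (fun x => swapn p q (f x))).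
Proof.
move=> tn pf pt qt.
have st x : (t <= swapn p q x) = (t <= x).
  rewrite /swapn; case: (x =P p) => [->|_]; first by rewrite !(leqNgt t) pt qt.
  by case: (x =P q) => [->|_] //; rewrite !(leqNgt t) pt qt.
have sid x : t <= x -> swapn p q x = x.
  by move=> tx; apply: swapn_neq; rewrite gtn_eqF //; apply: leq_trans tx.
apply: (@relabel_pgraph _ _ _ _ (swapn p q)) => //.
- move=> x xn; case: (leqP t x) => xt; first by rewrite sid.
  by apply: leq_trans tn; rewrite ltnNge st -ltnNge.
- by move=> x y _ _ /(congr1 (swapn p q)); rewrite !swapnK.
- by move=> x /andP[tx _]; rewrite /= (sid x tx).
Qed.

(** What depth-first order says about parents: the first child of a vertex
outside the clique comes right after it. *)
Definition depth_first t (f : nat -> nat) n :=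
  forall x, t <= x < n -> t <= f x -> f (f x).+1 = f x.

(** The labelled graph contains the clique and the edges to the parents, which
already give it the second moment of any clique with trees; equality of the
moments forces equality of the graphs. *)
Lemma tree_or_more_edges n t (G : sgraph n) : 2 < n -> 0 < t <= n -> in_L t G ->
  (exists f, [/\ parents t f n, depth_first t f n & isomorphic G (pgraph n t f)]) \/
  (forall f, parents t f n -> S_before (pgraph n t f) G).
Proof.
move=> n2 /andP[t0 tn] GL; have [s [f [pf fG dfs]]] := search_labelling t0 GL.
case: (boolP [forall x, [forall y, G (s x) (s y) == pgraph n t f x y]]) => [/forallP GE|nG].
  have {}GE x y : G (s x) (s y) = ptree t f x y.
    by rewrite -pgraphE; apply/eqP; apply: (forallP (GE x) y).
  left; exists f; split=> //; last first.
    apply/isomorphicP; exists s^-1%g => x y.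
    by rewrite pgraphE -GE !permKV.
  move=> x /andP[tx xn] tfx; have fx : f x < x by apply: pf; rewrite tx.
  have fn : (f x).+1 < n by apply: leq_ltn_trans xn.
  pose xo := Ordinal xn; pose y := Ordinal (ltnW fn); pose z := Ordinal fn.
  have e1 : ptree t f (f x) x by rewrite /ptree (ltn_eqF fx) tx eqxx !orbT.
  have := dfs y xo z tfx fx; rewrite !GE /= => /(_ e1 erefl);
    rewrite ptree_sym (@ptree_leaf t f (f x).+1 (f x)) ?(leqW tfx) //.
    by move=> /eqP.
  by apply: parentsW pf.
right=> f' pf'; apply: (S_before_first (k := 2)) => //.
  by case=> [|[|//]] _; rewrite ?spectral_moment0 ?spectral_moment1.
rewrite (spectral_moment2_parents tn pf' pf) !spectral_moment2 ltr_nat.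
rewrite [X in _ < X](reindex_inj (@perm_inj _ s)) /=.
have -> : \sum_(x < n) \sum_y G (s x) y = \sum_(x < n) \sum_(y < n) G (s x) (s y).
  by apply: eq_bigr => x _; rewrite (reindex_inj (@perm_inj _ s)).
rewrite !pair_big /=.
have le (p : 'I_n * 'I_n) : true -> pgraph n t f p.1 p.2 <= G (s p.1) (s p.2)
    ?= iff (G (s p.1) (s p.2) == pgraph n t f p.1 p.2).
  move=> _; have := fG p.1 p.2; rewrite pgraphE.
  by case: ptree => [->//|_]; case: (G _ _); split.
have [le1 eq1] := leqif_sum le.
rewrite ltn_neqAle le1 andbT eq1; apply: contra nG => /forallP h.
by apply/forallP => x; apply/forallP => y; apply: (h (x, y)).
Qed.

(** In the second case the branching vertex f x0 already has the child f x0 + 1. *)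
Variant few_branchings t n f : Prop :=
  | NoBranching of forall x, t < x < n -> f x = x.-1
  | OneBranching x0 of t < x0 < n & t <= f x0 & (f x0).+1 < x0 &
      forall x, t < x < n -> x != x0 -> f x = x.-1
  | TwoAttachments x0 of t = 3 & t < x0 < n & f x0 < t & f x0 != f t &
      forall x, t < x < n -> x != x0 -> f x = x.-1.

(** The vertex t is attached to a clique vertex of degree t - 1.  The other
attachment degrees are at least 1, and the bound on their sum leaves room
for a single 2.  A vertex attached to a leaf outside the clique is the first
child of its parent, hence follows it immediately in depth-first order. *)
Lemma classify_trees t n f : 2 < t < n -> parents t f n -> depth_first t f n ->
  \sum_(t <= x < n) attach_deg t f x < n -> few_branchings t n f.
Proof.
move=> /andP[t2 tn] pf dfs.
have att x : t <= x < n -> attach_deg t f x =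
    (if f x < t then t.-1 else 1) + children t f x (f x).
  by move=> /andP[tx xn]; apply: attach_degE => //; apply: parentsW pf.
have child x y : t <= y < x -> f y = f x -> 0 < children t f x (f x).
  move=> hy fyx; rewrite /children (bigD1_seq y) ?iota_uniq //=;
    last by rewrite mem_index_iota.
  by rewrite fyx eqxx.
have childP x : children t f x (f x) != 0 -> exists2 y, t <= y < x & f y = f x.
  rewrite /children sum_nat_seq_neq0 => /hasP[y]; rewrite mem_index_iota => hy.
  by rewrite eqb0 negbK => /eqP; exists y.
have ft : f t < t by apply: pf; rewrite leqnn.
rewrite (big_ltn tn) att ?leqnn // ft.
have one x : t < x < n -> attach_deg t f x = 1 -> f x = x.-1.
  move=> /andP[tx xn]; rewrite att ?xn ?(ltnW tx) //; case: ltnP => fx; first lia.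
  move=> h; have fxx : f x < x by apply: pf; rewrite xn ltnW.
  apply/eqP; rewrite -eqSS prednK ?(leq_ltn_trans _ tx) // eqn_leq fxx /= leqNgt.
  apply/negP => lt; have := child x (f x).+1; rewrite lt leqW // dfs ?xn ?(ltnW tx) //.
  by move=> /(_ isT erefl); lia.
move=> hs; have [| | |] := @sum_near_min (attach_deg t f) t.+1 n tn.
- by move=> x hx; rewrite att; [case: ifP|]; lia.
- by move: hs; lia.
- by move=> h; apply: NoBranching => x hx; apply: one => //; apply: h.
case=> x0 [hx0 a2 h]; have hx0' : t <= x0 < n by lia.
have others x : t < x < n -> x != x0 -> f x = x.-1.
  by move=> hx xx; apply: one => //; apply: h.
move: a2; rewrite att //; case: ltnP => fx a2.
  apply: (@TwoAttachments _ _ _ x0) => //; first lia.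
  apply/eqP => e; have := child x0 t; rewrite -e leqnn; lia.
have [y hy fy] : exists2 y, t <= y < x0 & f y = f x0 by apply: childP; lia.
apply: (@OneBranching _ _ _ x0) => //.
rewrite -fy; have : f y < y by apply: pf; lia.
lia.
Qed.

(** * Kites and kites with a branch *)

Lemma S_before_poly n (G H : sgraph n) :
  poly_before (char_poly (adjmx G)) (char_poly (adjmx H)) -> S_before G H.
Proof. by move=> /andP[sz pos]; apply: S_before_char_poly. Qed.

Lemma attach_pathE e v N s x y :
  attach_path e v N s x y =
  e x y || (N <= y < N + s) && (x == if y == N then v else y.-1).
Proof.
rewrite /attach_path; congr orb; apply/hasP/idP => [[k]|/andP[hy /eqP xE]].
  rewrite mem_iota add0n => /andP[_ ks] /andP[/eqP -> /eqP ->] /=.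
  apply/andP; split; first lia.
  case: k ks => [|k] ks /=; first by rewrite addn0 eqxx.
  have -> : (N + k.+1 == N) = false by lia.
  by rewrite addnS /=.
exists (y - N); first by rewrite mem_iota add0n; lia.
rewrite xE /=; apply/andP; split; last lia.
case: (y =P N) hy => [-> _|yN hy]; first by rewrite subnn.
by case E: (y - N) => [|k] /=; lia.
Qed.

Lemma of_edges_pgraph n t f (e : rel nat) :
  (forall x y, y < n -> e x y = (x < t) && (y < t) || (t <= y) && (x == f y)) ->
  forall x y, of_edges n e x y = pgraph n t f x y.
Proof.
move=> he x y; rewrite pgraphE /= /of_edges_adj !he ?ltn_ord // /ptree -val_eqE /=.
congr (_ && _); rewrite [(y < t) && _]andbC orbACA orbb.
by rewrite [X in _ || X]orbC.
Qed.

Lemma kite_pgraph n t x y : t <= n -> kite n t x y = pgraph n t (kite_parent t) x y.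
Proof.
move=> tn; apply: of_edges_pgraph => {}x {}y yn.
by rewrite /kite_edge attach_pathE subnKC // yn andbT.
Qed.

Lemma kite_branch_pgraph n t i j x y : 0 < i -> 0 < j -> t + i < n ->
  kite_branch n t i j x y = pgraph n t (branch_parent t (n - i) (t + j).-1) x y.
Proof.
move=> i0 j0 tin; apply: of_edges_pgraph => {}x {}y yn.
rewrite /kite_edge !attach_pathE /branch_parent -orbA; congr (_ || _).
have -> : t + (n - t - i) = n - i by lia.
have -> : n - i + i = n by lia.
rewrite yn andbT; case: (y =P n - i) => [->|yi].
  have -> : kite_vertex t j = (t + j).-1 by case: j j0 => //= j _; rewrite addnS.
  by rewrite ltnn leqnn andbF /=; have -> : t <= n - i by lia.
case: (ltnP y (n - i)) => h; first by rewrite andbT /= orbF.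
rewrite andbF /= /kite_parent; have -> : (y == t) = false by lia.
by have -> : t <= y by lia.
Qed.

Lemma char_poly_kite n t b j : 1 < t -> n = t + b + j ->
  char_poly (adjmx (kite n t)) = branch_poly t 0 b j.
Proof.
move=> t1 ->; rewrite (char_poly_isomorphic (isomorphic_eq _ : isomorphic _ (pgraph _ t
  (kite_parent t)))).
  rewrite char_poly_pgraph -addnA det_kite // /branch_poly (addnC b).
  by have -> : (pathp 'X 0 = 0 :> {poly algC})%R by []; rewrite !mul0r subr0 mul1r.
by move=> x y; apply: kite_pgraph; rewrite -addnA leq_addr.
Qed.

Lemma char_poly_kite_branch n t i j : 1 < t -> 0 < i -> 0 < j -> t + i + j <= n ->
  char_poly (adjmx (kite_branch n t i j)) = kite_branch_poly t (n - t) i j.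
Proof.
move=> t1 i0 j0 hn.
rewrite (char_poly_isomorphic (isomorphic_eq _ :
   isomorphic _ (pgraph _ t (branch_parent t (n - i) (t + j).-1)))).
  have nE : n = t + j + (n - t - i - j) + i by lia.
  rewrite char_poly_pgraph /kite_branch_poly -det_branch // -nE.
  by have -> : t + j + (n - t - i - j) = n - i by lia.
by move=> x y; apply: kite_branch_pgraph => //; lia.
Qed.

Lemma in_L_eq n t (G H : sgraph n) : (forall x y, G x y = H x y) -> in_L t H -> in_L t G.
Proof.
move=> GH; rewrite /in_L /clique_number.
have -> : connected G = connected H.
  by apply: eq_forallb => x; apply: eq_forallb => y; apply: eq_connect.
congr (_ && (_ == _)); apply: eq_bigl => A.
by do 2 (apply: eq_forallb => ?; congr (_ ==> _)); rewrite GH.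
Qed.

(** A clique with a vertex outside the first t ones is contained in the pair
formed by its last vertex and the parent of that vertex. *)
Lemma in_L_pgraph n t f : 1 < t <= n -> parents t f n -> in_L t (pgraph n t f).
Proof.
move=> /andP[t1 tn] pf; apply/andP; split.
  have n0 : 0 < n by apply: leq_trans tn; apply: ltnW.
  pose v0 := Ordinal n0.
  have c0 (x : 'I_n) : connect (pgraph n t f) x v0.
    have [k] := ubnP (val x); elim: k x => // k IH x; rewrite ltnS => xk.
    case: (ltnP x t) => xt.
      case: (x =P v0) => [->|/eqP xv]; first exact: connect0.
      apply: connect1; rewrite pgraphE /ptree xt (ltnW t1) /= andbT.
      by move: xv; rewrite -val_eqE.
    have fx : f x < x by apply: pf; rewrite xt ltn_ord.
    have fn : f x < n by apply: ltn_trans (ltn_ord x).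
    apply: (@connect_trans _ _ (Ordinal fn)); last by apply: IH; apply: leq_trans xk.
    by apply: connect1; rewrite pgraphE /ptree xt eqxx /= (gtn_eqF fx) orbT.
  apply/forallP => x; apply/forallP => y; apply: connect_trans (c0 x) _.
  by rewrite (sym_connect_sym (adj_sym _)).
rewrite /clique_number eqn_leq; apply/andP; split.
  apply/bigmax_leqP => B /forallP cB.
  have adjB x y : x \in B -> y \in B -> x != y -> ptree t f x y.
    move=> xB yB xy; rewrite -pgraphE.
    by have := forallP (implyP (cB x) xB) y; rewrite yB xy.
  case: (boolP [exists x : 'I_n, (x \in B) && (t <= x)]) => [/existsP[x0 hx0]|nx].
    case: (@arg_maxnP _ x0 (fun x : 'I_n => (x \in B) && (t <= x)) val hx0).
    move=> x /andP[xB tx] xmax.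
    have fx : f x < x by apply: pf; rewrite tx ltn_ord.
    have fn : f x < n by apply: ltn_trans (ltn_ord x).
    apply: leq_trans t1; rewrite -[2]/(1 + 1) -[X in X + _](cards1 x).
    rewrite -[X in _ + X](cards1 (Ordinal fn)); apply: leq_trans (leq_card_setU _ _).
    apply/subset_leq_card/subsetP => y yB; rewrite !inE.
    case: (eqVneq y x) => //= yx.
    have yltx : y < x.
      rewrite ltn_neqAle -[_ != _]/(y != x) yx /=.
      by case: (leqP t y) => ty; [apply: xmax; rewrite yB | apply: ltnW;
        apply: leq_trans tx].
    by have := adjB _ _ xB yB; rewrite eq_sym yx (ptree_leaf (parentsW (ltn_ord x) pf))
      // => /(_ isT).
  apply: leq_trans (_ : #|[set widen_ord tn x | x : 'I_t]| <= t).
    apply/subset_leq_card/subsetP => y yB.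
    have yt : y < t.
      by rewrite ltnNge; apply: contra nx => ty; apply/existsP; exists y; rewrite yB.
    by apply/imsetP; exists (Ordinal yt) => //; apply: val_inj.
  by apply: leq_trans (leq_imset_card _ _) _; rewrite card_ord.
pose A := [set widen_ord tn x | x : 'I_t].
have cA : #|A| = t.
  by rewrite card_imset ?card_ord // => x y h; apply: val_inj; exact: (congr1 val h).
rewrite -{1}cA; apply: leq_bigmax_cond.
apply/forallP => x; apply/implyP => /imsetP[x' _ ->].
apply/forallP => y; apply/implyP => /imsetP[y' _ ->]; apply/implyP => xy.
by rewrite pgraphE /ptree /= !ltn_ord /= andbT.
Qed.

(** * Normal forms and the list *)

Lemma sum_attach_branch n t x0 z : 0 < t -> t <= z -> z.+1 < x0 -> x0 < n ->
  \sum_(t <= x < n) attach_deg t (branch_parent t x0 z) x < n.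
Proof.
move=> t0 tz zx xn; set f := branch_parent t x0 z.
have pf m : parents t f m by apply: branch_parent_parents => //; lia.
have fE (x : nat) : x != x0 -> t < x -> f x = x.-1.
  by move=> /negPf xx tx; rewrite /f /branch_parent xx /kite_parent (gtn_eqF tx).
have fx0 : f x0 = z by rewrite /f /branch_parent eqxx.
have ft : f t = 0 by rewrite /f /branch_parent /kite_parent eqxx; case: eqP; lia.
have le x : t < x < n -> attach_deg t f x <= 1 + (x == x0).
  move=> /andP[tx xn']; rewrite attach_degE ?(ltnW tx) //.
  have -> : (f x < t) = false.
    by case: (x =P x0) => [->|/eqP xx]; rewrite ?fx0 ?fE //; lia.
  rewrite leq_add2l /children; case: (x =P x0) => [->|/eqP xx]; last first.
    rewrite big_nat_cond big1 // => y /andP[/andP[ty yx] _]; rewrite (fE x) //.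
    by have := pf n y; case: eqP => // -> h; lia.
  rewrite fx0 (eq_big_nat _ _ (F2 := fun y => (y == z.+1) : nat)) => [|y /andP[ty yx]].
    rewrite (bigD1_seq z.+1) ?iota_uniq //=; last by rewrite mem_index_iota; lia.
    by rewrite eqxx big1 // => y /negPf ->.
  case: (t =P y) => [<-|yt]; first by rewrite ft; lia.
  by rewrite fE; lia.
rewrite big_ltn; last lia.
rewrite attach_degE // ft t0 /children big_geq // addn0.
have : \sum_(t.+1 <= x < n) attach_deg t f x <= \sum_(t.+1 <= x < n) (1 + (x == x0)).
  by rewrite !big_nat; apply: leq_sum => x; apply: le.
have -> : \sum_(t.+1 <= x < n) (1 + (x == x0)) = n - t.+1 + 1.
  rewrite big_split /= sum_nat_const_nat muln1; congr (_ + _).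
  rewrite (bigD1_seq x0) ?iota_uniq //=; last by rewrite mem_index_iota; lia.
  by rewrite eqxx big1 // => y /negPf ->.
lia.
Qed.

Lemma swapn_pred t p q x : p < t -> q < t -> t < x -> swapn p q x.-1 = x.-1.
Proof. by move=> pt qt tx; apply: swapn_neq; lia. Qed.

Lemma no_branching_normal_form n t f : 0 < t < n -> parents t f n ->
  (forall x, t < x < n -> f x = x.-1) -> isomorphic (pgraph n t f) (kite n t).
Proof.
move=> /andP[t0 tn] pf hf; have ft : f t < t by apply: pf; rewrite leqnn.
apply: isomorphic_trans (swap_clique (ltnW tn) pf t0 ft) _.
apply: (@isomorphic_trans _ _ (pgraph n t (kite_parent t))).
  apply: eq_pgraph => x; rewrite leq_eqVlt /kite_parent => /andP[/predU1P[<-|tx] xn].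
    by rewrite eqxx /swapn eqxx; case: (f t =P 0).
  by rewrite (gtn_eqF tx) (hf x) ?tx // (swapn_pred t0 ft tx).
by apply: isomorphic_eq => x y; rewrite kite_pgraph // ltnW.
Qed.

Lemma one_branching_normal_form n t f x0 : 0 < t -> parents t f n -> t < x0 < n ->
  t <= f x0 ->
  (forall x, t < x < n -> x != x0 -> f x = x.-1) ->
  isomorphic (pgraph n t f) (pgraph n t (branch_parent t x0 (f x0))).
Proof.
move=> t0 pf /andP[tx0 xn0] tf hf; have tn : t < n by lia.
have ft : f t < t by apply: pf; rewrite leqnn.
apply: isomorphic_trans (swap_clique (ltnW tn) pf t0 ft) _.
apply: eq_pgraph => x; rewrite leq_eqVlt /branch_parent /kite_parent =>
  /andP[/predU1P[<-|tx] xn].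
  by rewrite (ltn_eqF tx0) eqxx /swapn eqxx; case: (f t =P 0).
case: (x =P x0) => [->|/eqP xx]; first by rewrite swapn_neq; lia.
by rewrite (gtn_eqF tx) (hf x) ?tx // (swapn_pred t0 ft tx).
Qed.

(** Two exchanges inside the triangle bring the attachment vertices to 0 and 1. *)
Lemma two_attachments_normal_form n f x0 : parents 3 f n -> 3 < x0 < n -> f x0 < 3 ->
  f x0 != f 3 -> (forall x, 3 < x < n -> x != x0 -> f x = x.-1) ->
  isomorphic (pgraph n 3 f) (pgraph n 3 (branch_parent 3 x0 1)).
Proof.
move=> pf /andP[tx0 xn0] fx0 ne hf; have tn : 3 < n by lia.
have ft : f 3 < 3 by apply: pf; rewrite tn.
pose f1 x := swapn 0 (f 3) (f x).
have f13 : f1 3 = 0 by rewrite /f1 /swapn eqxx; case: (f 3 =P 0).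
have f1x : f1 x0 < 3.
  by rewrite /f1 /swapn; case: (f x0 =P 0) => // _; rewrite (negPf ne).
have f1x0 : f1 x0 != 0.
  rewrite /f1 /swapn; case: (f x0 =P 0) => [e|/eqP]; first by move: ne; rewrite e eq_sym.
  by rewrite (negPf ne).
have f1E x : 3 < x < n -> x != x0 -> f1 x = x.-1.
  by move=> hx xx; rewrite /f1 (hf x) // (swapn_pred (isT : 0 < 3) ft) //; case/andP: hx.
have pf1 : parents 3 f1 n.
  move=> x; rewrite leq_eqVlt => /andP[/predU1P[<-|tx] xn]; first by rewrite f13.
  case: (x =P x0) => [->|/eqP xx]; last by rewrite f1E ?tx //; lia.
  by apply: leq_trans f1x (ltnW tx0).
apply: isomorphic_trans (swap_clique (ltnW tn) pf (isT : 0 < 3) ft) _.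
apply: isomorphic_trans (swap_clique (ltnW tn) pf1 (isT : 1 < 3) f1x) _.
apply: eq_pgraph => x; rewrite leq_eqVlt /branch_parent /kite_parent =>
  /andP[/predU1P[<-|tx] xn].
  by rewrite (ltn_eqF tx0) eqxx f13 swapn_neq // eq_sym.
case: (x =P x0) => [->|/eqP xx].
  by rewrite /swapn eqxx; case: (f1 x0 =P 1).
by rewrite (gtn_eqF tx) (f1E x) ?tx // (swapn_pred (isT : 1 < 3) f1x).
Qed.

(** Exchanges the names of the two pendant paths, which occupy consecutive
intervals of labels. *)
Lemma flip_arms n t x0 z : 0 < t -> t <= z -> z.+1 < x0 -> x0 < n ->
  isomorphic (pgraph n t (branch_parent t x0 z))
    (pgraph n t (branch_parent t (z.+1 + (n - x0)) z)).
Proof.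
move=> t0 tz zx xn.
pose r x := if x <= z then x else if x < x0 then x + (n - x0) else x - (x0 - z.+1).
have rlo x : x <= z -> r x = x by rewrite /r => ->.
have rmid x : z < x < x0 -> r x = x + (n - x0).
  by rewrite /r => /andP[h ->]; rewrite leqNgt h.
have rhi x : x0 <= x -> r x = x - (x0 - z.+1).
  by move=> h; rewrite /r ltnNge h /=; case: ifP => //; lia.
have rP x : [\/ x <= z /\ r x = x, z < x < x0 /\ r x = x + (n - x0)
              | x0 <= x /\ r x = x - (x0 - z.+1)].
  case: (leqP x z) => h1; first by apply: Or31; rewrite rlo.
  case: (ltnP x x0) => h2; first by apply: Or32; split=> //; apply: rmid; rewrite h1.
  by apply: Or33; split=> //; apply: rhi.
apply: (@relabel_pgraph _ _ _ _ r).
- by apply: branch_parent_parents => //; lia.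
- by move=> x xn'; case: (rP x) => -[h ->]; lia.
- by move=> x y xn' yn; case: (rP x) => -[h ->]; case: (rP y) => -[h' ->]; lia.
- by move=> x xn'; case: (rP x) => -[h ->]; lia.
move=> x /andP[tx xn']; rewrite {2}/branch_parent.
case: (x =P x0) => [->|/eqP xx].
  rewrite rhi // rlo // /branch_parent /kite_parent.
  have -> : x0 - (x0 - z.+1) = z.+1 by lia.
  have -> : (z.+1 == z.+1 + (n - x0)) = false by lia.
  by have -> : (z.+1 == t) = false by lia.
rewrite /kite_parent; case: (x =P t) => [->|/eqP xt].
  rewrite (rlo t) // rlo // /branch_parent /kite_parent eqxx.
  by have -> : (t == z.+1 + (n - x0)) = false by lia.
case: (leqP x z) => h1.
  rewrite !rlo; [|lia|lia]; rewrite /branch_parent /kite_parent (negPf xt).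
  by have -> : (x == z.+1 + (n - x0)) = false by lia.
case: (x =P z.+1) => [->|/eqP xz].
  by rewrite rmid ?ltnSn //= rlo // /branch_parent eqxx.
case: (ltnP x x0) => h2.
  rewrite !rmid; [|lia|lia]; rewrite /branch_parent /kite_parent.
  have -> : (x + (n - x0) == z.+1 + (n - x0)) = false by lia.
  have -> : (x + (n - x0) == t) = false by lia.
  lia.
rewrite !rhi; [|lia|lia]; rewrite /branch_parent /kite_parent.
have -> : (x - (x0 - z.+1) == z.+1 + (n - x0)) = false by lia.
have -> : (x - (x0 - z.+1) == t) = false by lia.
lia.
Qed.

Lemma branch_parent_kite_branch n t i j : 0 < i -> 0 < j -> t + i < n ->
  isomorphic (pgraph n t (branch_parent t (n - i) (t + j).-1)) (kite_branch n t i j).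
Proof. by move=> i0 j0 hn; apply: isomorphic_eq => x y; rewrite kite_branch_pgraph. Qed.

Section ListedOrder.
Variables n t : nat.
Hypotheses (t2 : 2 < t) (tn : t + 4 <= n).
Local Notation kb := (kite_branch n t).

Lemma S_before_kite_branch i j i' j' : 0 < i -> 0 < j -> t + i + j <= n ->
  0 < i' -> 0 < j' -> t + i' + j' <= n ->
  poly_before (kite_branch_poly t (n - t) i j) (kite_branch_poly t (n - t) i' j') ->
    S_before (kb i j) (kb i' j').
Proof.
by move=> *; apply: S_before_poly; rewrite !char_poly_kite_branch //; apply: ltnW.
Qed.

Definition block i := [seq kb i j | j <- rev (index_iota i.+1 (n - t - 2 * i).+1)].

Lemma rev_iota_S m k : rev (iota m k.+1) = m + k :: rev (iota m k).
Proof. by rewrite -addn1 iotaD rev_cat. Qed.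

Lemma block_sorted (G : sgraph n) i : 0 < i -> 3 * i < n - t ->
  S_before G (kb i (n - t - 2 * i)) ->
  @path (sgraph n) (@S_before n) G (block i) /\ last G (block i) = kb i i.+1.
Proof.
move=> i0 hi; rewrite /block /index_iota.
have [k [-> hk]] : exists k, (n - t - 2 * i).+1 - i.+1 = k.+1 /\ n - t - 2 * i = i.+1 + k.
  by exists (n - t - 3 * i).-1; lia.
rewrite hk => hG; have hle : t + i + (i.+1 + k) <= n by lia.
elim: k G {hk} hG hle => [|k IH] G hG hle; first by rewrite /= addn0 in hG *; rewrite hG.
rewrite rev_iota_S; set l := rev _ in IH *;
  rewrite [map _ _]/= [path _ _ _]/= [last _ _]/= hG /=.
apply: IH; last lia.
have hd : i + (i.+1 + k).+1 <= n - t by lia.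
apply: S_before_kite_branch; try lia.
by rewrite addnS; apply: kite_branch_poly_decr.
Qed.

Definition blocks k := flatten [seq block i | i <- iota 1 k].

Lemma first_graphsE m : first_graphs n t m = kite n t :: blocks m.
Proof. by rewrite /first_graphs /index_iota subSS subn0. Qed.

Lemma blocks_sorted k : 3 * k < n - t ->
  @path (sgraph n) (@S_before n) (kite n t) (blocks k) /\
  last (kite n t) (blocks k) = if k is 0 then kite n t else kb k k.+1.
Proof.
elim: k => [|k IH] hk //; have [|p l] := IH; first lia.
have -> : blocks k.+1 = blocks k ++ block k.+1.
  by rewrite /blocks -[in LHS](addn1 k) iotaD map_cat flatten_cat /= cats0 add1n.
rewrite cat_path last_cat p l /=.
have d3 : 3 < n - t by lia.
apply: block_sorted => //.
case: k hk {IH p l} => [|k] hk.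
  apply: S_before_poly; rewrite muln1 char_poly_kite_branch //; [|exact: ltnW|lia|lia].
  rewrite (@char_poly_kite n t 0 (n - t)); [|exact: ltnW|lia].
  by apply: kite_before_first_branch => //; lia.
apply: S_before_kite_branch; try lia.
by apply: kite_branch_poly_next => //; lia.
Qed.

Lemma size_blocks m : size (blocks m) = \sum_(1 <= i < m.+1) (n - t - 3 * i).
Proof.
rewrite /blocks size_flatten /shape -map_comp sumnE big_map /index_iota subSS subn0.
by apply: eq_bigr => i _; rewrite /= /block size_map size_rev size_iota; lia.
Qed.

Lemma has_flatten (T : Type) (a : pred T) ss : has a (flatten ss) = has (has a) ss.
Proof. by elim: ss => //= s ss <-; rewrite has_cat. Qed.

Lemma all_flatten (T : Type) (a : pred T) ss : all a (flatten ss) = all (all a) ss.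
Proof. by elim: ss => //= s ss <-; rewrite all_cat. Qed.

Lemma has_blocks (G : sgraph n) m i j : 0 < i <= m -> i < j <= n - t - 2 * i ->
  isomorphic G (kb i j) -> has (isomorphic G) (blocks m).
Proof.
move=> hi hj iso; rewrite /blocks has_flatten has_map; apply/hasP; exists i.
  by rewrite mem_iota; lia.
rewrite /= /block has_map; apply/hasP; exists j => //.
by rewrite mem_rev mem_index_iota; lia.
Qed.

Lemma blocks_in_L m : 3 * m < n - t -> all (in_L t) (blocks m).
Proof.
move=> hm; rewrite /blocks all_flatten all_map; apply/allP => i; rewrite mem_iota => hi.
rewrite /= /block all_map; apply/allP => j; rewrite mem_rev mem_index_iota => hj /=.
apply: (@in_L_eq _ _ _ (pgraph n t (branch_parent t (n - i) (t + j).-1))).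
  by move=> x y; apply: kite_branch_pgraph; lia.
by apply: in_L_pgraph; [lia | apply: branch_parent_parents; lia].
Qed.

Lemma kite_in_L : in_L t (kite n t).
Proof.
apply: (@in_L_eq _ _ _ (pgraph n t (kite_parent t))); first by move=> x y;
  apply: kite_pgraph; lia.
by apply: in_L_pgraph; [lia | apply: kite_parent_parents; lia].
Qed.

(** A graph that is not settled by its second or fourth moment has one of three
shapes.  The kite and the graphs G_j^i with i < j are listed; the graphs
G_j^i with j <= i and the triangles with two pendant paths are compared
through their characteristic polynomials. *)
Lemma listed_or_after m (G : sgraph n) : m = (n - t - 1) %/ 3 -> in_L t G ->
  ~~ isomorphic G (kite n t) -> ~~ has (isomorphic G) (blocks m) ->
  S_before (kb m m.+1) G.
Proof.
move=> hm GL nkite nblocks; have d3 : 3 < n - t by lia.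
have m0 : 0 < m by lia.
have t1 : 1 < t by apply: ltnW.
pose f0 := branch_parent t (n - m) (t + m.+1).-1.
have pf0 : parents t f0 n by apply: branch_parent_parents; lia.
have T0 : isomorphic (kb m m.+1) (pgraph n t f0).
  by apply: isomorphic_eq => x y; apply: kite_branch_pgraph; lia.
have cT := char_poly_isomorphic T0.
have [[f [pf dfs Gf]]|after] := tree_or_more_edges (ltac:(lia) : 2 < n)
    (ltac:(lia) : 0 < t <= n) GL; last first.
  by rewrite (S_before_congr cT (erefl _)); apply: after.
have cG := char_poly_isomorphic Gf.
case: (ltnP (\sum_(t <= x < n) attach_deg t f x) n) => [few|many]; last first.
  rewrite (S_before_congr cT cG); apply: S_before_attach_deg => //; try lia.
  apply: leq_trans many; apply: sum_attach_branch; lia.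
have arms a b j : 0 < a -> 0 < b -> 0 < j -> t + j + b + a = n ->
    isomorphic G (pgraph n t (branch_parent t (n - a) (t + j).-1)) ->
    a <= b -> S_before (kb m m.+1) G.
  move=> a0 b0 j0 nE iso ab; have isoG : isomorphic G (kb a j).
    by apply: isomorphic_trans iso _; apply: branch_parent_kite_branch => //; lia.
  case: (leqP j a) => ja; last first.
    by case/negP: nblocks; apply: has_blocks isoG; lia.
  rewrite (S_before_congr (erefl _) (char_poly_isomorphic isoG)).
  apply: S_before_kite_branch => //; try lia.
  by apply: last_listed_before => //; lia.
have hlt : 2 < t < n by lia.
case: (classify_trees hlt pf dfs few) => [hf|x0 hx0 tf fx hf|x0 t3 hx0 fx ne hf].
- case/negP: nkite; apply: isomorphic_trans Gf _.
  by apply: no_branching_normal_form => //; lia.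
- have iso := isomorphic_trans Gf (one_branching_normal_form (ltnW (ltnW t2)) pf hx0 tf hf).
  set z := f x0 in tf fx iso.
  case: (leqP (n - x0) (x0 - z.+1)) => ab.
    apply: (arms (n - x0) (x0 - z.+1) (z - t).+1) => //; try lia.
    have -> : n - (n - x0) = x0 by lia.
    by have -> : (t + (z - t).+1).-1 = z by lia.
  apply: (arms (x0 - z.+1) (n - x0) (z - t).+1) => //; try lia.
  apply: isomorphic_trans iso _.
  have -> : n - (x0 - z.+1) = z.+1 + (n - x0) by lia.
  have -> : (t + (z - t).+1).-1 = z by lia.
  by apply: flip_arms; lia.
have iso : isomorphic G (pgraph n t (branch_parent t x0 1)).
  apply: isomorphic_trans Gf _.
  by move: t3 pf fx ne hf hx0 => -> pf fx ne hf hx0; apply: two_attachments_normal_form.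
rewrite (S_before_congr (erefl _) (char_poly_isomorphic iso)).
apply: S_before_poly; rewrite char_poly_kite_branch //; try lia.
rewrite char_poly_pgraph t3.
have nE : n = 3 + (x0 - 3) + (n - x0) by lia.
have -> : det_n n (char_fun 3 (branch_parent 3 x0 1)) = two_path_poly (n - x0) (x0 - 3).
  by rewrite -det_triangle -nE; have -> : 3 + (x0 - 3) = x0 by lia.
by apply: last_listed_before_triangle => //; lia.
Qed.
End ListedOrder.

Theorem theorem3p5 (n t m : nat) (ht : 3 <= t) (htn : t + 4 <= n)
    (hm : m = (n - t - 1) %/ 3) :
  [/\ size (first_graphs n t m) = (\sum_(1 <= i < m.+1) (n - t - 3 * i)).+1,
      all (in_L t) (first_graphs n t m),
      sorted (@S_before n) (first_graphs n t m)
    & forall G : sgraph n,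
        in_L t G -> ~~ has (isomorphic G) (first_graphs n t m) ->
        S_before (kite_branch n t m m.+1) G].
Proof.
have hm3 : 3 * m < n - t by lia.
rewrite first_graphsE; split.
- by rewrite [LHS]/= size_blocks.
- by apply/andP; split; [apply: kite_in_L | apply: blocks_in_L].
- by have [] := blocks_sorted ht htn hm3.
- by move=> G GL; rewrite negb_or => /andP[]; apply: listed_or_after.
Qed.
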